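(* Let $k=k(r)$ be an integer with $3\le k\le r+1$ for each integer $r\ge 2$. The following hold as $r\to\infty$. (i) If $k/\log r\to c\in(0,\infty)$, then $$1-128\left(c^{-1/2}+c^{-1}\right)+o(1)\le \frac{r\,\pi(H_k^r)}{k-2}\le 1.$$ (ii) If $\log(er/k)=o(k)$, then $$\pi(H_k^r)=(1+o(1))\frac{k-2}{r}.$$ (iii) If $k/r\to\alpha\in(0,1)$ and $\beta=\min\{\alpha,1-\alpha\}$, then $$0\le \frac{k-2}{r}-\pi(H_k^r)\le \frac{128\sqrt{\beta\log(e/\beta)}+o(1)}{\sqrt r}.$$
   Context: An $r$-graph is an $r$-uniform hypergraph. For $r\ge 2$ and $3\le k\le r+1$, $H_k^r$ denotes the $r$-graph on $r+1$ vertices with exactly $k$ edges (unique up to isomorphism, since each $r$-subset of an $(r+1)$-set omits exactly one vertex). An $r$-graph $G$ is $H$-free if it contains no copy of $H$ as a (not necessarily induced) subgraph. $\mathrm{ex}(n,H)$ is the maximum number of edges in an $H$-free $r$-graph on $n$ vertices, and the Turán density is $\pi(H)=\lim_{n\to\infty}\mathrm{ex}(n,H)/\binom{n}{r}$. $\log$ denotes the natural logarithm and $e$ its base. $a_r=o(b_r)$ means $a_r/b_r\to 0$ as $r\to\infty$. *)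

(* Defs.v *)
From mathcomp Require Import all_boot all_order all_algebra.
From mathcomp Require Import all_classical all_reals all_analysis.

Set Implicit Arguments.
Unset Strict Implicit.
Unset Printing Implicit Defensive.

Import Order.TTheory GRing.Theory Num.Theory.
Import numFieldNormedType.Exports.

(* A hypergraph on V is its set of edges. *)
Definition hypergraph (V : finType) := {set {set V}}.

Definition is_rgraph (V : finType) (r : nat) (G : hypergraph V) : bool :=
  [forall e in G, #|e| == r].

(* G contains a (not necessarily induced) copy of H. *)
Definition has_copy (U V : finType) (H : hypergraph U) (G : hypergraph V)
  : bool :=
  [exists f : {ffun U -> V},
     injectiveb f && [forall e in H, (f @: e)%SET \in G]].

(* ex(n, H): the maximum number of edges in an H-free r-graph on n vertices. *)
Definition turan_number (U : finType) (r n : nat) (H : hypergraph U) : nat :=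
  \max_(G : hypergraph 'I_n | is_rgraph r G && ~~ has_copy H G) #|G|.

(* The terms with n < r are the junk value x / 0 = 0, which is irrelevant to
   the limit. *)
Definition turan_density (R : realType) (U : finType) (r : nat)
    (H : hypergraph U) : R :=
  limn (fun n => (turan_number r n H)%:R / 'C(n, r)%:R : R)%R.

(* H_k^r for k <= r.+1: every r-subset of the r.+1 vertices omits exactly one
   vertex, and the edges are those omitting one of the first k vertices. *)
Definition Hgraph (k r : nat) : hypergraph 'I_r.+1 :=
  [set ~: [set i] | i : 'I_r.+1 & (i < k)%N]%SET.

Lemma Hgraph_rgraph (k r : nat) : is_rgraph r (Hgraph k r).
Proof.
apply/forall_inP => e /imsetP[i _ ->].
by rewrite cardsC1 card_ord.
Qed.

Lemma card_Hgraph (k r : nat) : (k <= r.+1)%N -> #|Hgraph k r| = k.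
Proof.
move=> lekr; rewrite card_in_imset; last first.
  by move=> i j _ _ /finset.setC_inj/finset.set1_inj.
have winj : injective (widen_ord lekr).
  by move=> i j /(congr1 val) /= ij; apply: val_inj.
rewrite -[RHS]card_ord -(card_imset _ winj).
apply: eq_card => i; rewrite inE; apply/idP/imsetP => [ik|[j _ ->]].
  by exists (Ordinal ik) => //; apply: val_inj.
by rewrite /= ltn_ord.
Qed.

(* Main.v *)
Require Import Defs.
From mathcomp Require Import all_boot all_order all_algebra.
From mathcomp Require Import all_classical all_reals all_analysis.
From mathcomp Require Import zify ring lra.
Set Implicit Arguments.
Unset Strict Implicit.
Unset Printing Implicit Defensive.
Import Order.TTheory GRing.Theory Num.Theory.
Import numFieldNormedType.Exports.

(** Write K = k - 2. An r-graph is free of H_k^r exactly when every set of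
    r + 1 vertices contains fewer than k edges, and the theorem follows from
    the two-sided estimate

      K - 28 (sqrt (m L) + L) <= r pi(H_k^r) <= K,
      where m = min(K, r - K) and L = log(e r / m).

    Upper bound ([turan_density_upper]). An edge e and a vertex w outside e
    span an (r+1)-set, which contains at most K edges besides e. This bounds
    the number of pairs of edges that share r - 1 vertices, and the
    Cauchy-Schwarz inequality for the codegrees turns that bound into one on
    the number of edges.

    Lower bound, the construction. Let the vertices be the residues mod n. For
    a set e of r residues let b(e) be the largest l such that every cyclic arc
    of length l contains at most K points of e, and call e an edge when
    sum(e) - a lies in [0, b(e)). Given an (r+1)-set T, put c = sum(T) - a; then
    T - v is an edge precisely when c - v lies in [0, b(T - v)). Choosing v0
    among these v so as to maximise b(T - v0), all of them lie in one arc of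
    length b(T - v0), which contains at most K points of T - v0, so T has at
    most K + 1 edges ([arc_graph_few_edges]). There is no loss at all from the
    fact that b varies with e. Averaging over a, the ratio ex(n) / C(n, r) is at
    least the mean of b(e) / n, and b(e) is at least the minimum over the r
    cyclic windows of the sum of K consecutive gaps of e ([sum_min_window_le]).

    Lower bound, the estimate. For a uniformly random set the gaps are not
    independent; weighting n geometrically makes them independent geometric
    variables ([geometric_min_window]). As their parameter tends to 0,
    r pi(H_k^r) becomes at least the expected minimum of all the cyclic windows
    of K consecutive terms among r independent variables of mean 1 and
    exponential moments. The expected sum of all the terms is known exactly, so
    that a window of K terms may be traded for the complementary window of
    r - K terms, and it is enough to control windows of m terms.
    Cutting the cycle in about r / m blocks and using Doob's maximal inequality
    in each of them, one gets a union bound over r / m events rather than r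
    ([window_deviation]): this is why L has r / m in it, and why the error is
    of order sqrt m when m is proportional to r. Optimising the exponential
    parameter gives [turan_density_lower_sqrt].

    The constant 28 is so much smaller than 128 that in (i) and (iii) the error
    terms can be taken to vanish for all large r. *)

(** * Free graphs and Turan numbers *)

(** Freeness as a local count. [few_edges_Hfree] and [Hfree_few_edges] show the
    equivalence with the absence of a copy of [Hgraph k r]: r-subsets of an
    (r+1)-set correspond to the vertex they omit, so any k of them form a copy. *)
Definition few_edges (V : finType) (k r : nat) (G : hypergraph V) : bool :=
  [forall T : {set V}, (#|T| == r.+1) ==>
     (#|[set v in T | T :\ v \in G]%SET| < k)%N].

Lemma few_edges_Hfree (V : finType) (k r : nat) (G : hypergraph V) :
  (k <= r.+1)%N -> few_edges k r G -> ~~ has_copy (Hgraph k r) G.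
Proof.
move=> kr /forallP few; apply/existsP => -[f /andP[/injectiveP finj /forall_inP fG]].
have /implyP := few (f @: [set: 'I_r.+1])%SET.
rewrite card_imset // cardsT card_ord eqxx => /(_ isT); rewrite ltnNge => /negP; apply.
have winj : injective (fun i : 'I_k => f (widen_ord kr i)).
  by move=> i j /finj/(congr1 val) /= ij; apply: val_inj.
rewrite -[leqLHS]card_ord -(card_imset _ winj).
apply/subset_leq_card/fintype.subsetP => _ /imsetP[i _ ->]; rewrite inE imset_f ?inE //=.
have -> : (f @: [set: 'I_r.+1] :\ f (widen_ord kr i) = f @: (~: [set widen_ord kr i]))%SET.
  apply/setP => v; apply/setD1P/imsetP => [[vi /imsetP[j _ vj]]|[j]].
    by exists j => //; rewrite !inE; apply: contra_neq vi => <-.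
  by rewrite !inE => ji ->; split; [rewrite (inj_eq finj)|rewrite imset_f ?inE].
by apply/fG/imsetP; exists (widen_ord kr i); rewrite // inE /= ltn_ord.
Qed.

Lemma Hfree_few_edges (V : finType) (k r : nat) (G : hypergraph V) :
  ~~ has_copy (Hgraph k r) G -> few_edges k r G.
Proof.
move=> /existsPn free; apply/forallP => T; apply/implyP => /eqP cT.
rewrite ltnNge; apply/negP => kA.
set A := [set v in T | _]%SET in kA.
(* Listing T with A first makes the first k vertices of H omit points of A. *)
pose s := (enum A ++ enum (T :\: A)%SET).
have AT : A \subset T by apply/fintype.subsetP => v; rewrite inE => /andP[].
have ss : size s = r.+1.
  rewrite size_cat -!cardE -cT -(cardsID A T); congr (_ + _)%N.
  by rewrite (finset.setIidPr AT).
have us : uniq s.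
  rewrite cat_uniq !enum_uniq andbT /=; apply/hasPn => v.
  by rewrite !mem_enum !inE => /andP[].
(* A default value for [nth]. *)
have [v0 _] : exists v, v \in T.
  by apply/set0Pn; rewrite -card_gt0 cT.
pose f := [ffun i : 'I_r.+1 => nth v0 s i].
have finj : injective f.
  move=> i j; rewrite !ffunE => /eqP; rewrite nth_uniq ?ss ?ltn_ord //.
  by move=> /eqP ij; apply: val_inj.
have fT : (f @: [set: 'I_r.+1] = T)%SET.
  apply/eqP; rewrite eqEcard card_imset // cardsT card_ord cT leqnn andbT.
  apply/fintype.subsetP => _ /imsetP[i _ ->]; rewrite ffunE.
  have := mem_nth v0 (_ : i < size s)%N; rewrite ss ltn_ord => /(_ isT).
  by rewrite mem_cat !mem_enum => /orP[/(fintype.subsetP AT)|/setDP[]].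
have /negP := free f; apply; apply/andP; split; first exact/injectiveP.
apply/forall_inP => e /imsetP[i]; rewrite inE => ik ->.
have -> : (f @: (~: [set i]) = T :\ f i)%SET.
  apply/setP => v; rewrite -fT; apply/imsetP/setD1P => [[j]|[vi /imsetP[j _ vj]]].
    by rewrite !inE => ji ->; split; [rewrite (inj_eq finj)|rewrite imset_f ?inE].
  by exists j => //; rewrite !inE; apply: contra_neq vi => <-.
have : f i \in A.
  rewrite ffunE nth_cat -cardE (leq_trans ik kA) -mem_enum mem_nth //.
  by rewrite -cardE (leq_trans ik kA).
by rewrite inE => /andP[].
Qed.

Lemma leq_turan_number (U : finType) (r n : nat) (H : hypergraph U)
    (G : hypergraph 'I_n) :
  is_rgraph r G -> ~~ has_copy H G -> (#|G| <= turan_number r n H)%N.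
Proof.
move=> rG HG; rewrite /turan_number.
by apply: (@leq_bigmax_cond _ _ (fun G : {set {set 'I_n}} => #|G|) G); rewrite rG.
Qed.

Lemma turan_numberP (U : finType) (r n m : nat) (H : hypergraph U) :
  (forall G : hypergraph 'I_n, is_rgraph r G -> ~~ has_copy H G -> (#|G| <= m)%N) ->
  (turan_number r n H <= m)%N.
Proof. by move=> Gm; apply/bigmax_leqP => G /andP[]; apply: Gm. Qed.

Lemma turan_number_le_bin (U : finType) (r n : nat) (H : hypergraph U) :
  (turan_number r n H <= 'C(n, r))%N.
Proof.
apply: turan_numberP => G /forall_inP rG _.
rewrite -[n in leqRHS]card_ord -card_draws.
by apply/subset_leq_card/fintype.subsetP => e /rG; rewrite inE.
Qed.

(** Katona-Nemetz-Simonovits averaging: an edge survives the deletion of any of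
    the n + 1 - r vertices outside it, and each deletion leaves a free graph. *)
Lemma turan_number_averaging (U : finType) (r n : nat) (H : hypergraph U) :
  ((n.+1 - r) * turan_number r n.+1 H <= n.+1 * turan_number r n H)%N.
Proof.
rewrite {1}/turan_number.
apply: (big_ind (fun m => ((n.+1 - r) * m <= n.+1 * turan_number r n H)%N)).
- by rewrite muln0.
- by move=> x y; case: (leqP x y).
move=> G /andP[/forall_inP rG /existsPn HG].
have -> : ((n.+1 - r) * #|G| = \sum_v #|[set e in G | v \notin e]%SET|)%N.
  under eq_bigr do rewrite -sum1dep_card.
  rewrite (exchange_big_dep (mem G)) /=; last by move=> ? ? _ /andP[].
  rewrite mulnC -sum_nat_const; apply: eq_bigr => e eG.
  have <- : #|(~: e)%SET| = (n.+1 - r)%N.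
    by rewrite cardsCs finset.setCK card_ord (eqP (rG e eG)).
  by rewrite -sum1_card; apply: eq_bigl => v; rewrite inE eG.
rewrite -[X in (_ <= X * _)%N]card_ord -sum_nat_const; apply: leq_sum => v _.
pose L (e : {set 'I_n}) := (lift v @: e)%SET.
have Linj : injective L by apply/imset_inj/lift_inj.
pose G' : hypergraph 'I_n := [set e | L e \in G]%SET.
have -> : [set e in G | v \notin e]%SET = (L @: G')%SET.
  apply/setP => e; rewrite inE; apply/andP/imsetP => [[eG ve]|[e']].
    have eL : e = L (lift v @^-1: e)%SET.
      apply/setP => w; apply/idP/imsetP => [we|[u]]; last by rewrite inE => ? ->.
      have [w' ww' | wv] := unliftP v w; last by rewrite -wv we in ve.
      by exists w' => //; rewrite inE -ww'.
    by exists (lift v @^-1: e)%SET => //; rewrite inE -eL.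
  rewrite inE => e'G ->; split => //.
  by apply/negP => /imsetP[w _ /eqP]; rewrite (negbTE (neq_lift _ _)).
rewrite card_imset //; apply: leq_turan_number.
  apply/forall_inP => e; rewrite inE => /rG; rewrite card_imset //; exact: lift_inj.
apply/existsPn => f; apply: contra (HG [ffun u => lift v (f u)]).
move=> /andP[/injectiveP fi /forall_inP fG].
apply/andP; split.
  by apply/injectiveP => x y; rewrite !ffunE => /lift_inj/fi.
apply/forall_inP => e /fG; rewrite inE /L -imset_comp.
by rewrite (eq_imset _ (_ : _ =1 [ffun u => lift v (f u)])) // => u; rewrite ffunE.
Qed.

(** * Existence of the density and the upper bound *)

(** Pairs (S, v) with S + v an edge are the same as pairs (e, v) with v in e. *)
Lemma sum_codegree (V : finType) (r : nat) (G : hypergraph V) (F : {set V} -> nat) :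
  is_rgraph r.+1 G ->
  (\sum_(S : {set V} | #|S| == r)
     #|[set v | (v \notin S) && (v |: S \in G)]%SET| * F S
   = \sum_(e in G) \sum_(v in e) F (e :\ v)%SET)%N.
Proof.
move=> /forall_inP rG.
under [LHS]eq_bigr => S _ do rewrite -sum1dep_card big_distrl /=.
rewrite (exchange_big_dep xpredT) //= [RHS](exchange_big_dep xpredT) //=.
apply: eq_bigr => v _.
rewrite (reindex_onto (fun e => e :\ v)%SET (fun S => v |: S)%SET) /=; last first.
  by move=> S /and3P[_ vS _]; rewrite finset.setU1K.
apply: eq_big => [e|e _]; last by rewrite mul1n.
have [ve|ve] := boolP (v \in e); last first.
  rewrite andbF; apply/negP => /andP[_ /eqP eE].
  by rewrite -eE finset.setU11 in ve.
rewrite finset.setD1K // finset.setD11 eqxx !andbT /=.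
have [/rG /eqP|] := boolP (e \in G); last by rewrite andbF.
by rewrite (cardsD1 v e) ve add1n => -[->]; rewrite eqxx.
Qed.

Lemma sqr_sum_le (I : finType) (P : pred I) (f : I -> nat) :
  ((\sum_(i | P i) f i) ^ 2 <= #|P| * \sum_(i | P i) f i * f i)%N.
Proof.
set s := (\sum_(i | P i) f i)%N.
have : (\sum_(i | P i) 2 * ((#|P| * f i) * s)
        <= \sum_(i | P i) ((#|P| * f i) ^ 2 + s ^ 2))%N.
  by apply: leq_sum => i _; apply: nat_Cauchy.
rewrite -big_distrr -big_distrl -big_distrr /= -/s big_split /= sum_nat_const.
under [X in (_ <= X + _)%N]eq_bigr do rewrite expnMn.
rewrite -big_distrr /=.
under [X in (_ <= _ * X + _)%N]eq_bigr do rewrite -mulnn.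
set q := (\sum_(i | P i) f i * f i)%N.
have [P0|Pp] := posnP #|P|.
  by rewrite /s big1 // => i Pi; have := card0_eq P0 i; rewrite !inE /= unfold_in Pi.
move=> h; rewrite -(leq_pmul2l Pp); nia.
Qed.

(** Summing squared codegrees counts triples (e, v, f) where f is an edge that
    contains e - v. Apart from f = e, the edge f is e - v + w for some w outside
    e, and for each w there are at most K of them. *)
Lemma few_edges_upper (V : finType) (K r : nat) (G : hypergraph V) :
  is_rgraph r.+1 G -> few_edges K.+2 r.+1 G ->
  (r.+1 * (#|V| - r) * #|G| <= 'C(#|V|, r.+1) * (r.+1 + (#|V| - r.+1) * K))%N.
Proof.
move=> rG /forallP few.
have [->|Gp] := posnP #|G|; first by rewrite muln0.
pose d (S : {set V}) := #|[set v | (v \notin S) && (v |: S \in G)]%SET|.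
have sumd : (\sum_(S : {set V} | #|S| == r) d S = #|G| * r.+1)%N.
  under eq_bigr do rewrite -[d _]muln1.
  rewrite (sum_codegree (fun=> 1%N) rG) -sum_nat_const; apply: eq_bigr => e eG.
  by rewrite sum1_card; apply/eqP/(forall_inP rG).
have sumd2 : (\sum_(S : {set V} | #|S| == r) d S * d S
              <= #|G| * (r.+1 + (#|V| - r.+1) * K))%N.
  rewrite (sum_codegree d rG) -sum_nat_const; apply: leq_sum => e eG.
  have ce := eqP (forall_inP rG e eG).
  have dle v : v \in e ->
      (d (e :\ v)%SET <= 1 + \sum_(w | w \notin e) ((w |: e) :\ v \in G)%SET)%N.
    move=> ve; rewrite /d (cardsD1 v); apply: leq_add; first exact: leq_b1.
    rewrite -big_mkcondr sum1dep_card; apply/subset_leq_card/fintype.subsetP => w.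
    rewrite !inE => /and3P[wv]; rewrite wv /= => we weG; rewrite we /=.
    rewrite (_ : (w |: e) :\ v = w |: (e :\ v))%SET //.
    by apply/setP => x; rewrite !inE; case: (x =P w) => // ->; rewrite wv.
  apply: (@leq_trans (\sum_(v in e) (1 + \sum_(w | w \notin e)
           ((w |: e) :\ v \in G)%SET))%N); first exact: leq_sum.
  rewrite big_split /= sum1_card ce leq_add2l exchange_big /=.
  have -> : (#|V| - r.+1)%N = #|[pred w | w \notin e]|.
    by rewrite -ce -(cardC e) addKn; apply: eq_card.
  rewrite -sum_nat_const; apply: leq_sum => w we.
  rewrite -big_mkcondr sum1dep_card.
  have /implyP := few (w |: e)%SET; rewrite cardsU1 we ce add1n eqxx => /(_ isT).
  rewrite (cardsD1 w) inE finset.setU11 finset.setU1K // eG add1n !ltnS.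
  apply: leq_trans; apply/subset_leq_card/fintype.subsetP => v.
  rewrite !inE => /andP[ve ->]; rewrite ve orbT !andbT.
  by apply: contraNneq we => <-.
have := sqr_sum_le [pred S : {set V} | #|S| == r] d.
rewrite /= sumd => /leq_trans/(_ (leq_mul (leqnn _) sumd2)).
have -> : #|[pred S : {set V} | #|S| == r]| = 'C(#|V|, r).
  by rewrite -card_draws; apply: eq_card => S; rewrite !inE.
have := mul_bin_left #|V| r.
set a := 'C(_, _); set b := 'C(_, _); set m := (#|V| - r)%N; set c := (_ + _)%N.
move=> eqab le1.
rewrite -(leq_pmul2l (ltn0Sn r)) -(leq_pmul2l Gp).
have -> : (#|G| * (r.+1 * (a * c)) = m * (b * (#|G| * c)))%N by rewrite mulnA mulnA; nia.
have -> : (#|G| * (r.+1 * (r.+1 * m * #|G|)) = m * (#|G| * r.+1)^2)%N by nia.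
by rewrite leq_mul2l le1 orbT.
Qed.

Section density.
Local Open Scope classical_set_scope.
Local Open Scope ring_scope.

Lemma turan_ratio_nonincreasing (R : realType) (U : finType) (r : nat) (H : hypergraph U) :
  nonincreasing_seq
    (fun n => (turan_number r (n + r) H)%:R / 'C(n + r, r)%:R : R).
Proof.
apply/nonincreasing_seqP => n; rewrite addSn.
have Cp m : 0 < 'C(m + r, r)%:R :> R by rewrite ltr0n bin_gt0 leq_addl.
rewrite ler_pdivrMr -?addSn // mulrAC ler_pdivlMr // -!natrM ler_nat addSn.
have := turan_number_averaging r (n + r) H.
have := mul_bin_down (n + r).+1 r; rewrite /=.
have -> : ((n + r).+1 - r = n.+1)%N by lia.
set a := 'C(_, _); set b := 'C(_, _); set x := turan_number _ _ _.
set y := turan_number _ _ _ => e1 e2.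
rewrite -(leq_pmul2l (ltn0Sn (n + r))).
have -> : ((n + r).+1 * (x * a) = n.+1 * x * b)%N by rewrite mulnCA e1; lia.
have -> : ((n + r).+1 * (y * b) = (n + r).+1 * y * b)%N by rewrite mulnA.
by rewrite leq_mul2r e2 orbT.
Qed.

(** The ratios decrease by averaging, so the limit in the definition of the
    density is a genuine one. *)
Lemma turan_ratio_cvg (R : realType) (U : finType) (r : nat) (H : hypergraph U) :
  (turan_number r n H)%:R / 'C(n, r)%:R @[n --> \oo] --> turan_density R r H.
Proof.
have h : cvgn (fun n => (turan_number r (n + r) H)%:R / 'C(n + r, r)%:R : R).
  apply: nonincreasing_is_cvgn; first exact: turan_ratio_nonincreasing.
  by exists 0 => _ [n _ <-]; rewrite divr_ge0.
move: h => /cvg_ex[l hl].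
have hl' : (turan_number r n H)%:R / 'C(n, r)%:R @[n --> \oo] --> (l : R).
  by rewrite -(cvg_shiftn r).
by rewrite /turan_density (cvg_lim (@Rhausdorff R) hl').
Qed.

Lemma turan_density_ge0 (R : realType) (U : finType) (r : nat) (H : hypergraph U) :
  0 <= turan_density R r H.
Proof.
rewrite -(cvg_lim (@Rhausdorff R) (@turan_ratio_cvg R _ r H)).
apply: limr_ge; first by apply: cvgP; exact: turan_ratio_cvg.
by near=> n; rewrite divr_ge0.
Unshelve. all: by end_near. Qed.

(** For r-graphs on N vertices the count of pairs of edges gives
    r ex(N) / C(N, r) <= K + r / (N - r + 1). *)
Lemma turan_density_upper (R : realType) (K r : nat) :
  r.+1%:R * turan_density R r.+1 (Hgraph K.+2 r.+1) <= K%:R.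
Proof.
set H := Hgraph _ _.
have c1 : r.+1%:R * ((turan_number r.+1 n H)%:R / 'C(n, r.+1)%:R) @[n --> \oo]
     --> r.+1%:R * turan_density R r.+1 H.
  by apply: cvgMr; exact: turan_ratio_cvg.
have c2 : K%:R + r.+1%:R * n.+1%:R^-1 @[n --> \oo] --> (K%:R + r.+1%:R * 0 : R).
  apply: cvgD; first exact: cvg_cst.
  by apply: cvgMr; exact: cvg_harmonic.
have {}c1 :
    r.+1%:R * ((turan_number r.+1 (n + r.+1) H)%:R / 'C(n + r.+1, r.+1)%:R)
    @[n --> \oo] --> r.+1%:R * turan_density R r.+1 H.
  by rewrite (cvg_shiftn r.+1
    (fun n => r.+1%:R * ((turan_number r.+1 n H)%:R / 'C(n, r.+1)%:R) : R)).
rewrite mulr0 addr0 in c2.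
apply: (ler_cvg_to c1 c2); near=> n.
set N := (n + r.+1)%N.
have Cp : 0 < 'C(N, r.+1)%:R :> R by rewrite ltr0n bin_gt0 leq_addl.
have ub : (r.+1 * n.+1 * turan_number r.+1 N H <= 'C(N, r.+1) * (r.+1 + n.+1 * K))%N.
  have : (turan_number r.+1 N H <= ('C(N, r.+1) * (r.+1 + n.+1 * K)) %/ (r.+1 * n.+1))%N.
    apply: turan_numberP => G rG fG; rewrite leq_divRL // mulnC.
    have := few_edges_upper rG (Hfree_few_edges fG); rewrite card_ord.
    have -> : (N - r = n.+1)%N by rewrite /N; lia.
    move=> /leq_trans; apply; rewrite leq_mul2l leq_add2l leq_mul2r.
    by apply/orP; right; apply/orP; right; rewrite /N; lia.
  by rewrite leq_divRL // mulnC.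
rewrite mulrA ler_pdivrMr // -(ler_pM2l (_ : 0 < n.+1%:R :> R)) ?ltr0n //.
have -> : n.+1%:R * ((K%:R + r.+1%:R / n.+1%:R) * 'C(N, r.+1)%:R)
          = ('C(N, r.+1) * (r.+1 + n.+1 * K))%:R :> R.
  rewrite natrM natrD natrM; field.
  by rewrite addrC natr1 pnatr_eq0.
have -> : n.+1%:R * (r.+1%:R * (turan_number r.+1 N H)%:R)
          = (r.+1 * n.+1 * turan_number r.+1 N H)%:R :> R.
  by rewrite !natrM; ring.
by rewrite ler_nat.
Unshelve. all: by end_near. Qed.

End density.

(** * The construction on the cyclic group *)

(** Arcs are read backwards: the points of the arc of length [l] ending at [u]
    are the [v] with [u - v < l]. It is enough to look at arcs ending at points
    of [e], by [sparse_arc_card]. *)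
Definition sparse_arcs (n K : nat) (e : {set 'I_n.+1}) (l : nat) : bool :=
  [forall u in e, (#|[set v in e | (u - v)%R < l]%SET| <= K)%N].

Definition sparse_length (n K : nat) (e : {set 'I_n.+1}) : nat :=
  \max_(l < n.+2 | sparse_arcs K e l) l.

Lemma sparse_length_le (n K : nat) (e : {set 'I_n.+1}) :
  (sparse_length K e <= n.+1)%N.
Proof. by apply/bigmax_leqP => l _; rewrite -ltnS ltn_ord. Qed.

Lemma sparse_length_max (n K : nat) (e : {set 'I_n.+1}) (l : nat) :
  (l <= n.+1)%N -> sparse_arcs K e l -> (l <= sparse_length K e)%N.
Proof.
rewrite -ltnS => ln sl.
exact: (@leq_bigmax_cond _ (fun l : 'I_n.+2 => sparse_arcs K e l)
  (fun l => l : nat) (Ordinal ln)).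
Qed.

Lemma sparse_arcs_length (n K : nat) (e : {set 'I_n.+1}) :
  sparse_arcs K e (sparse_length K e).
Proof.
have s0 : sparse_arcs K e (ord0 : 'I_n.+2).
  apply/forall_inP => u _.
  by rewrite [leqLHS]eq_card0 // => v; rewrite !inE andbF.
rewrite /sparse_length (bigop.bigmax_eq_arg ord0) //.
by case: arg_maxnP.
Qed.

Lemma val_subr (n : nat) (x y : 'I_n.+1) :
  (y <= x)%N -> ((x - y)%R : nat) = (x - y)%N.
Proof.
move=> yx; rewrite /= modnDmr addnBA; last exact: ltnW.
by rewrite addnC -addnBA // modnDl modn_small // (leq_ltn_trans (leq_subr _ _)).
Qed.

Lemma val_subr_arc (n : nat) (c u v : 'I_n.+1) (l : nat) :
  (((c - u)%R : nat) <= (c - v)%R)%N -> ((c - v)%R < l)%N -> ((u - v)%R < l)%N.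
Proof.
have -> : (u - v = (c - v) - (c - u))%R by rewrite opprB [RHS]addrC addrA subrK.
move: (c - u)%R (c - v)%R => x y xy.
by rewrite val_subr //; apply: leq_ltn_trans; exact: leq_subr.
Qed.

(** Shortening an arc to its last point in [e] loses no point of [e]. *)
Lemma sparse_arc_card (n K l : nat) (e : {set 'I_n.+1}) (c : 'I_n.+1) :
  sparse_arcs K e l -> (#|[set v in e | (c - v)%R < l]%SET| <= K)%N.
Proof.
move=> /forall_inP sl.
set C := [set v in e | _]%SET.
have [->|/set0Pn[u0 u0C]] := eqVneq C finset.set0.
  by rewrite cards0.
case: (@arg_minnP _ u0 (mem C) (fun u => (c - u)%R : nat) u0C) => u /= uC umin.
move: (uC); rewrite inE => /andP[ue _].
apply: leq_trans (sl u ue); apply/subset_leq_card/fintype.subsetP => v vC.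
move: (vC); rewrite !inE => /andP[-> vl] /=.
exact: val_subr_arc (umin v vC) vl.
Qed.

Definition arc_graph (n K r : nat) (a : 'I_n.+1) : hypergraph 'I_n.+1 :=
  [set e : {set 'I_n.+1} | (#|e| == r) &&
     ((\sum_(v in e) v - a)%R < sparse_length K e)%N]%SET.

Lemma arc_graph_rgraph (n K r : nat) (a : 'I_n.+1) : is_rgraph r (arc_graph K r a).
Proof. by apply/forall_inP => e; rewrite inE => /andP[]. Qed.

(** The edges of T are among the [T - v] with v in one arc, of the length given by
    the subset [T - v0] for which that length is largest. *)
Lemma arc_graph_few_edges (n K r : nat) (a : 'I_n.+1) :
  few_edges K.+2 r (arc_graph K r a).
Proof.
apply/forallP => T; apply/implyP => /eqP cT.
set A := [set v in T | _]%SET.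
have [->|/set0Pn[w wA]] := eqVneq A finset.set0; first by rewrite cards0.
case: (@arg_maxnP _ w (mem A) (fun v => sparse_length K (T :\ v)%SET) wA)
  => v0 /= v0A v0max.
have v0T : v0 \in T by move: v0A; rewrite inE => /andP[].
rewrite ltnS (cardsD1 v0) v0A add1n ltnS.
apply: leq_trans (sparse_arc_card (\sum_(v in T) v - a)%R (sparse_arcs_length K (T :\ v0)%SET)).
apply/subset_leq_card/fintype.subsetP => v.
move=> /finset.setD1P[vv0 vA]; rewrite !inE (negbTE vv0) andTb.
move: (v0max v vA); move: (vA); rewrite !inE => /and3P[vT _ sv] le.
rewrite vT andTb; apply: leq_trans le; apply: leq_trans sv; rewrite ltnS.
suff -> : (\sum_(w in T) w - a - v = \sum_(w in (T :\ v)%SET) w - a)%R by [].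
by rewrite (big_setD1 v vT) /= addrAC [(v + _)%R]addrC addrK.
Qed.

Lemma sum_arc_graph (n K r : nat) :
  (\sum_(a : 'I_n.+1) #|arc_graph K r a|
   = \sum_(e : {set 'I_n.+1} | #|e| == r) sparse_length K e)%N.
Proof.
under eq_bigr do rewrite -sum1_card.
rewrite (exchange_big_dep (fun e : {set 'I_n.+1} => #|e| == r)); last first.
  by move=> a e _; rewrite finset.in_set => /andP[].
apply: eq_bigr => e re.
under eq_bigl do rewrite andTb finset.in_set re andTb.
rewrite sum1dep_card.
set s := (\sum_(v in e) v)%R.
have winj : injective (fun j : 'I_(sparse_length K e) => s - widen_ord (sparse_length_le K e) j)%R.
  by move=> i j /addrI/oppr_inj/(congr1 val) /= ij; apply: val_inj.
rewrite -[RHS]card_ord -(card_imset _ winj); apply: eq_card => a.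
rewrite finset.in_set; apply/idP/imsetP => [sa|[j _ ->]].
  exists (Ordinal sa) => //; rewrite (_ : widen_ord _ _ = (s - a)%R) ?subKr //.
  exact: val_inj.
by rewrite subKr; exact: (ltn_ord j).
Qed.

(** Each set [e] is an edge for exactly [sparse_length K e] of the shifts [a]. *)
Lemma turan_number_ge_sparse (n K r : nat) :
  (K.+2 <= r.+1)%N ->
  (\sum_(e : {set 'I_n.+1} | #|e| == r) sparse_length K e
   <= n.+1 * turan_number r n.+1 (Hgraph K.+2 r))%N.
Proof.
move=> Kr; rewrite -sum_arc_graph -[X in (_ <= X * _)%N]card_ord -sum_nat_const.
apply: leq_sum => a _; apply: leq_turan_number; first exact: arc_graph_rgraph.
by apply: few_edges_Hfree => //; exact: arc_graph_few_edges.
Qed.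

(** * Gaps of a set of residues *)

(** [g] lists the gaps, minus one, between cyclically consecutive points. Indices
    are taken mod r + 1, so that positions extend periodically to all of [nat]
    and windows may wrap around. *)
Definition gap (M r : nat) (g : {ffun 'I_r.+1 -> 'I_M}) (t : nat) : nat :=
  (g (inZp t)).+1.

Definition pos (M r : nat) (g : {ffun 'I_r.+1 -> 'I_M}) (j : nat) : nat :=
  \sum_(t < j) gap g t.

Definition min_window (M r K : nat) (g : {ffun 'I_r.+1 -> 'I_M}) : nat :=
  let W (i : 'I_r.+1) := (pos g (i + K) - pos g i)%N in
  W [arg min_(i < ord0) W i].

Section gaps.
Variables (M r : nat).
Implicit Type g h : {ffun 'I_r.+1 -> 'I_M}.

Lemma posS g j : pos g j.+1 = (pos g j + gap g j)%N.
Proof. by rewrite /pos big_ord_recr. Qed.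

Lemma ltn_pos g i j : (pos g i < pos g j)%N = (i < j)%N.
Proof.
have lt_pos : {homo pos g : i j / (i < j)%N}.
  apply: homo_ltn => [? ? ?|{}j]; first exact: ltn_trans.
  by rewrite posS /gap addnS ltnS leq_addr.
exact: leqW_mono (leq_mono lt_pos) i j.
Qed.

Lemma leq_pos g i j : (pos g i <= pos g j)%N = (i <= j)%N.
Proof. by rewrite leqNgt ltn_pos -leqNgt. Qed.

Lemma pos0 g : pos g 0 = 0%N.
Proof. by rewrite /pos big_ord0. Qed.

Lemma pos_period g j : pos g (j + r.+1) = (pos g j + pos g r.+1)%N.
Proof.
elim: j => [|j IH]; first by rewrite pos0.
rewrite addSn (posS g (j + _)) (posS g j) IH addnAC /gap (_ : inZp (j + r.+1) = inZp j) //.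
by apply: val_inj; rewrite /= modnDr.
Qed.

Lemma pos_complement g i K k : (K + k = r.+1)%N ->
  (pos g (i + K) - pos g i + (pos g (i + K + k) - pos g (i + K)) = pos g r.+1)%N.
Proof.
move=> kK; rewrite addnC addnBA ?leq_pos ?leq_addr // subnK ?leq_pos ?leq_addr //.
by rewrite -addnA kK pos_period addKn.
Qed.

Lemma min_window_le K g i : (min_window K g <= pos g (i + K) - pos g i)%N.
Proof.
elim/ltn_ind: i => i IH; have [ir|ri] := ltnP i r.+1.
  rewrite /min_window; case: arg_minnP => //= i0 _ imin.
  exact: (imin (Ordinal ir)).
rewrite -(subnK ri) addnAC !pos_period subnDr.
by apply: IH; rewrite ltn_subrL (leq_trans _ ri).
Qed.

Section points.
Variable n : nat.

Definition points (x : 'I_n.+1) g : {set 'I_n.+1} :=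
  [set (x - inZp (pos g j))%R | j : 'I_r.+1]%SET.

Lemma sub_points (x : 'I_n.+1) a b : (a <= b)%N -> (b < n.+1 + a)%N ->
  (((x - inZp a) - (x - inZp b))%R : nat) = (b - a)%N.
Proof.
move=> ab bn.
have -> : ((x - inZp a) - (x - inZp b) = inZp (b - a))%R.
  rewrite opprB addrC addrA subrK.
  apply/eqP; rewrite subr_eq; apply/eqP; apply: val_inj.
  by rewrite /= modnDm subnK.
by rewrite /= modn_small //; lia.
Qed.

Lemma card_points (x : 'I_n.+1) g : pos g r.+1 = n.+1 -> #|points x g| = r.+1.
Proof.
move=> gn; rewrite card_imset ?card_ord // => i j.
move=> /addrI/oppr_inj/(congr1 val) /=.
rewrite !modn_small -?gn ?ltn_pos // => pij.
by case: (ltngtP i j) => [||/val_inj //]; rewrite -(ltn_pos g) pij ltnn.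
Qed.

(** The points met going backwards from the i-th one lie at the distances
    [pos g (i + t) - pos g i]. For t = K this is a window sum, so that only the
    first K of them, the i-th one included, are closer than the shortest window. *)
Lemma points_sparse K (x : 'I_n.+1) g : pos g r.+1 = n.+1 ->
  sparse_arcs K (points x g) (min_window K g).
Proof.
move=> gn; apply/forall_inP => _ /imsetP[i _ ->].
have wi := min_window_le K g i.
pose P := [set (x - inZp (pos g (i + t)))%R | t : 'I_K]%SET.
apply: (@leq_trans #|P|); last by rewrite -[leqRHS]card_ord leq_imset_card.
apply/subset_leq_card/fintype.subsetP => v; rewrite finset.in_set => /andP[].
move=> /imsetP[j0 _ ->].
have [j [ij jr ->]] : exists j, [/\ (i <= j)%N, (j < i + r.+1)%N &
     inZp (pos g j0) = inZp (pos g j) :> 'I_n.+1].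
  have [ij0|j0i] := leqP i j0.
    by exists j0; split => //; rewrite (leq_trans (ltn_ord j0)) // leq_addl.
  exists (j0 + r.+1)%N; split; rewrite ?ltn_add2r //.
    by rewrite (leq_trans (ltnW (ltn_ord i))) // leq_addl.
  by apply: val_inj; rewrite /= pos_period gn modnDr.
rewrite sub_points; last 2 first.
- by rewrite leq_pos.
- by rewrite -gn addnC -pos_period ltn_pos.
move=> jw; apply/imsetP.
have jK : (j < i + K)%N.
  by rewrite -(ltn_pos g); lia.
have jiK : (j - i < K)%N by lia.
by exists (Ordinal jiK) => //=; rewrite subnKC.
Qed.

(** The distances from [x] to the points are the positions, in increasing order;
    a strictly increasing sequence is determined by its set of values. *)
Lemma points_inj (x : 'I_n.+1) g h :
  pos g r.+1 = n.+1 -> pos h r.+1 = n.+1 -> points x g = points x h -> g = h.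
Proof.
move=> gn hn gh.
have mem_pos f (fn : pos f r.+1 = n.+1) m :
    (m \in [seq pos f j | j <- iota 0 r.+1]) = (m < n.+1)%N && ((x - inZp m)%R \in points x f).
  apply/mapP/andP => [[j]|[mn /imsetP[j _ /addrI/oppr_inj eqj]]].
    rewrite mem_iota add0n /= => jr ->; split; first by rewrite -fn ltn_pos.
    by apply/imsetP; exists (Ordinal jr).
  have := congr1 (fun i : 'I_n.+1 => i : nat) eqj.
  have -> : (inZp m : 'I_n.+1) = m :> nat by rewrite /= modn_small.
  have -> : (inZp (pos f j) : 'I_n.+1) = pos f j :> nat.
    by rewrite /= modn_small // -fn ltn_pos.
  by move=> ->; exists (j : nat); rewrite // mem_iota /= add0n.
have eqs : [seq pos g j | j <- iota 0 r.+1] = [seq pos h j | j <- iota 0 r.+1].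
  have sorted_pos (f : {ffun 'I_r.+1 -> 'I_M}) : sorted ltn [seq pos f j | j <- iota 0 r.+1].
    have lt_pos : {homo pos f : i j / (i < j)%N} by move=> i j; rewrite ltn_pos.
    exact: (homo_sorted lt_pos _ (iota_ltn_sorted 0 r.+1)).
  apply: (irr_sorted_eq ltn_trans ltnn) => // m.
  by rewrite !mem_pos // gh.
have eqp j : (j <= r.+1)%N -> pos g j = pos h j.
  rewrite leq_eqVlt => /orP[/eqP->|jr]; first by rewrite gn.
  have : nth 0%N [seq pos g i | i <- iota 0 r.+1] j
         = nth 0%N [seq pos h i | i <- iota 0 r.+1] j by rewrite eqs.
  by rewrite !(nth_map 0%N) ?size_iota // nth_iota.
apply/ffunP => j; apply: val_inj.
have := eqp j.+1 (ltn_ord j); rewrite !posS eqp; last exact: ltnW.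
move=> /addnI[]; rewrite /gap (_ : inZp j = j) //.
by apply: val_inj; rewrite /= modn_small.
Qed.

Lemma mem_points (x : 'I_n.+1) g : x \in points x g.
Proof.
apply/imsetP; exists ord0 => //; rewrite pos0 (_ : inZp 0 = 0%R) ?subr0 //.
by apply: val_inj; rewrite /= mod0n.
Qed.

(** A point [x] and a list of gaps determine, injectively, a set of r + 1 points
    with a distinguished one. Each list of gaps occurs with n + 1 points [x], and
    each set has r + 1 points to distinguish. *)
Lemma sum_min_window_le K : (K <= r)%N ->
  (\sum_(g : {ffun 'I_r.+1 -> 'I_M} | pos g r.+1 == n.+1) min_window K g
   <= r.+1 * turan_number r.+1 n.+1 (Hgraph K.+2 r.+1))%N.
Proof.
move=> Kr; rewrite -(leq_pmul2l (ltn0Sn n)) mulnCA.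
apply: leq_trans (leq_mul (leqnn _) (turan_number_ge_sparse n (_ : K.+2 <= r.+2)%N)) => //.
pose D := [pred p : 'I_n.+1 * {ffun 'I_r.+1 -> 'I_M} | pos p.2 r.+1 == n.+1].
pose Phi (p : 'I_n.+1 * {ffun 'I_r.+1 -> 'I_M}) := (p.1, points p.1 p.2).
have Phi_inj : {in D &, injective Phi}.
  move=> [x g] [y h]; rewrite !inE /= => /eqP gn /eqP hn [xy].
  by rewrite -{}xy => /points_inj ->.
have -> : (n.+1 * \sum_(g : {ffun 'I_r.+1 -> 'I_M} | pos g r.+1 == n.+1) min_window K g
          = \sum_(p in D) min_window K p.2)%N.
  rewrite -(pair_big_dep xpredT (fun _ g => pos g r.+1 == n.+1) (fun _ g => min_window K g)) /=.
  by rewrite sum_nat_const card_ord.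
apply: (@leq_trans (\sum_(p in D) sparse_length K (Phi p).2)%N).
  apply: leq_sum => -[x g]; rewrite inE /= => /eqP gn.
  apply: sparse_length_max; last exact: points_sparse.
  apply: leq_trans (min_window_le K g 0) _.
  by rewrite pos0 subn0 -gn leq_pos ltnW.
rewrite -(big_imset (fun q => sparse_length K q.2) Phi_inj) /=.
rewrite big_distrr /=.
under [leqRHS]eq_bigr => e /eqP re do rewrite -re -sum_nat_const.
rewrite (exchange_big_dep xpredT) //= pair_big_dep /=.
rewrite [leqLHS]big_mkcond [leqRHS]big_mkcond.
apply: leq_sum => q _; case: ifP => // /imsetP[[x g]]; rewrite inE /= => /eqP gn ->.
by rewrite card_points // eqxx mem_points.
Qed.
End points.
End gaps.

Local Open Scope ring_scope.

(** * Geometric weights on the gaps *)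

(** Partial sums of the series of z^(n-m) C(n, m), which is (1 - z)^-(m+1) for
    z = 1 - q; Pascal's rule gives the recursion. *)
Lemma negative_binomial_sum (R : realFieldType) (q : R) (N m : nat) :
  0 < q < 1 ->
  \sum_(n < N) 'C(n, m)%:R * (1 - q) ^+ (n - m) <= q ^- m.+1.
Proof.
move=> /andP[q0 q1]; have qn0 : q != 0 by rewrite gt_eqF.
elim: N m => [|N IH] m.
  by rewrite big_ord0 invr_ge0 exprn_ge0 // ltW.
case: m => [|m].
  rewrite big_ord_recl bin0 mul1r expr0 /=.
  under eq_bigr do rewrite /bump bin0 mul1r add1n subn0 exprS.
  rewrite -mulr_sumr.
  have := IH 0; under eq_bigr do rewrite bin0 mul1r subn0.
  move=> /(ler_wpM2l (_ : 0 <= 1 - q)); rewrite subr_ge0 ltW // => /(_ isT) h.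
  by rewrite -lerBrDl; apply: le_trans h _; rewrite expr1 mulrBl mul1r mulfV.
rewrite big_ord_recl bin0n mul0r add0r.
have -> : \sum_(i < N) 'C(lift ord0 i, m.+1)%:R * (1 - q) ^+ (lift ord0 i - m.+1)
   = (1 - q) * (\sum_(i < N) 'C(i, m.+1)%:R * (1 - q) ^+ (i - m.+1))
     + \sum_(i < N) 'C(i, m)%:R * (1 - q) ^+ (i - m).
  rewrite mulr_sumr -big_split; apply: eq_bigr => i _ /=.
  rewrite /bump add1n binS natrD mulrDl subSS; congr (_ + _).
  have [im|mi] := leqP i m; first by rewrite bin_small ?mul0r ?mulr0.
  by rewrite mulrCA -exprS -subSn.
have h1 := ler_wpM2l (_ : 0 <= 1 - q) (IH m.+1); have h2 := IH m.
apply: le_trans (lerD (h1 _) h2) _; first by rewrite subr_ge0 ltW.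
rewrite [q ^+ m.+2]exprS invfM.
by rewrite mulrBl mul1r mulrA mulfV // mul1r subrK.
Qed.

Section geometric.
Variables (R : realType) (M r K n0 : nat) (q c : R).
Hypotheses (q01 : 0 < q < 1) (c0 : 0 <= c) (Kr : (K <= r)%N).
Hypothesis turan_le : forall n, (n0 <= n)%N ->
  (turan_number r.+1 n (Hgraph K.+2 r.+1))%:R <= c * 'C(n, r.+1)%:R.

Let w (j : 'I_M) : R := q * (1 - q) ^+ j.

Lemma pos_sum (g : {ffun 'I_r.+1 -> 'I_M}) : pos g r.+1 = (\sum_i (g i).+1)%N.
Proof.
apply: eq_bigr => i _; rewrite /gap (_ : inZp i = i) //.
by apply: val_inj; rewrite /= modn_small.
Qed.

Lemma prod_weight (g : {ffun 'I_r.+1 -> 'I_M}) :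
  \prod_i w (g i) = q ^+ r.+1 * (1 - q) ^+ (pos g r.+1 - r.+1).
Proof.
rewrite /w big_split /= prodr_const card_ord; congr (_ * _).
rewrite prodrXr; congr (_ ^+ _); rewrite pos_sum.
under [in RHS]eq_bigr do rewrite -add1n.
by rewrite big_split /= sum_nat_const card_ord muln1 addKn.
Qed.

Lemma weight_ge0 (j : 'I_M) : 0 <= w j.
Proof.
by case/andP: q01 => q0 q1; rewrite mulr_ge0 ?exprn_ge0 ?subr_ge0 // ltW.
Qed.

Lemma sum_weight : \sum_j w j = 1 - (1 - q) ^+ M.
Proof.
rewrite -mulr_sumr; have := subrX1 (1 - q) M.
have -> : 1 - q - 1 = - q by ring.
by rewrite mulNr => eqM; rewrite -[LHS]opprK -eqM opprB.
Qed.

(** Independent geometric gaps have a weight that depends only on their total n,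
    so that grouping by n recovers the uniform measure on gap lists of total n.
    Totals below [n0], where the Turan ratio may exceed [c], contribute at most
    [n0], which the factor [q] makes negligible. The gaps are cut at M only to
    keep the sums finite; this discards nonnegative terms. *)
Lemma geometric_min_window :
  q * (\sum_(g : {ffun 'I_r.+1 -> 'I_M}) (\prod_i w (g i)) * (min_window K g)%:R)
  <= q * n0%:R + c * r.+1%:R.
Proof.
case/andP: (q01) => q0 q1.
have P0 (g : {ffun 'I_r.+1 -> 'I_M}) : 0 <= \prod_i w (g i).
  by apply: prodr_ge0 => i _; exact: weight_ge0.
rewrite (bigID (fun g : {ffun 'I_r.+1 -> 'I_M} => pos g r.+1 < n0)%N) /= mulrDr.
apply: lerD.
  rewrite ler_pM2l //.
  apply: (@le_trans _ _ (\sum_(g : {ffun 'I_r.+1 -> 'I_M}) (\prod_i w (g i)) * n0%:R)).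
    rewrite big_mkcond; apply: ler_sum => g _; case: ifP => [gn|_]; last by rewrite mulr_ge0.
    rewrite ler_wpM2l // ler_nat.
    apply: leq_trans (min_window_le K g 0) _; rewrite pos0 subn0.
    by apply: ltnW; apply: leq_ltn_trans gn; rewrite leq_pos ltnW.
  rewrite -mulr_suml -(bigA_distr_bigA (fun _ => w)) prodr_const sum_weight.
  rewrite ler_piMl // exprn_ile1 ?subr_ge0 ?exprn_ile1 ?gerBl ?exprn_ge0 ?subr_ge0 ?ltW //.
have tot_lt (g : {ffun 'I_r.+1 -> 'I_M}) : (pos g r.+1 < (r.+1 * M).+1)%N.
  rewrite ltnS pos_sum -[X in (_ <= X * _)%N]card_ord -sum_nat_const.
  by apply: leq_sum => i _; exact: ltn_ord.
rewrite (partition_big (fun g => Ordinal (tot_lt g)) xpredT) //=.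
rewrite -ler_pdivlMl // mulrA.
apply: (@le_trans _ _ (\sum_(n < (r.+1 * M).+1)
  q ^+ r.+1 * (1 - q) ^+ (n - r.+1) * (c * 'C(n, r.+1)%:R * r.+1%:R))).
  apply: ler_sum => n _.
  have z0 : 0 <= q ^+ r.+1 * (1 - q) ^+ (n - r.+1).
    by apply: mulr_ge0; apply: exprn_ge0; rewrite ?subr_ge0 ltW.
  have [n0n|nn0] := leqP n0 n; last first.
    rewrite big1 => [|g /andP[/negP h /eqP/(congr1 val) /= gn]].
      by apply: mulr_ge0 => //; rewrite !mulr_ge0.
    by rewrite gn in h.
  apply: (@le_trans _ _ (\sum_(g : {ffun 'I_r.+1 -> 'I_M} | pos g r.+1 == n)
      q ^+ r.+1 * (1 - q) ^+ (n - r.+1) * (min_window K g)%:R)).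
    rewrite big_mkcond [leRHS]big_mkcond; apply: ler_sum => g _; case: ifP.
      by move=> /andP[_ /eqP/(congr1 val) /= gn]; rewrite gn eqxx prod_weight gn.
    by case: ifP => // _ _; rewrite mulr_ge0.
  rewrite -mulr_sumr ler_wpM2l // -natr_sum.
  case: n n0n {z0} => -[|n] nM /= n0n.
    rewrite big1 ?mulr_ge0 // => g /eqP; rewrite pos_sum big_ord_recl.
    by rewrite addSn.
  apply: le_trans (ler_wpM2r (ler0n _ r.+1) (turan_le n0n)).
  by rewrite -natrM ler_nat mulnC; exact: sum_min_window_le.
rewrite (eq_bigr (fun n : 'I_(r.+1 * M).+1 => c * r.+1%:R * q ^+ r.+1
    * ('C(n, r.+1)%:R * (1 - q) ^+ (n - r.+1)))) => [|n _]; last by ring.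
rewrite -mulr_sumr.
apply: le_trans (ler_wpM2l _ (negative_binomial_sum _ _ q01)) _.
  by apply: mulr_ge0; [exact: mulr_ge0|apply/exprn_ge0/ltW].
rewrite [q ^+ r.+2]exprS invfM; set x := q ^+ r.+1.
have xn0 : x != 0 by rewrite expf_neq0 // gt_eqF.
have qn0 : q != 0 by rewrite gt_eqF.
rewrite le_eqVlt; apply/orP; left; apply/eqP; field.
by rewrite xn0 qn0.
Qed.
End geometric.

(** * Independent variables and Doob's inequality *)

Section iid.
Variables (R : realFieldType) (I T : finType) (mu : T -> R).
Hypotheses (mu_ge0 : forall t, 0 <= mu t) (mu_sum1 : \sum_t mu t = 1).
Implicit Types (F G : {ffun I -> T} -> R) (h : T -> R) (g : {ffun I -> T}).

Definition mean h : R := \sum_t mu t * h t.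

(** Expectation of a function of independent variables of common law [mu]. *)
Definition expect F : R := \sum_(g : {ffun I -> T}) (\prod_i mu (g i)) * F g.

Lemma expect_le F G : (forall g, F g <= G g) -> expect F <= expect G.
Proof.
move=> FG; apply: ler_sum => g _; apply: ler_wpM2l => //.
by apply: prodr_ge0.
Qed.

Lemma expectD F G : expect (fun g => F g + G g) = expect F + expect G.
Proof. by rewrite -big_split; apply: eq_bigr => g _; rewrite mulrDr. Qed.

Lemma expectZ a F : expect (fun g => a * F g) = a * expect F.
Proof. by rewrite mulr_sumr; apply: eq_bigr => g _; rewrite mulrCA. Qed.

Lemma expect_cst a : expect (fun=> a) = a.
Proof.
rewrite /expect -mulr_suml -(bigA_distr_bigA (fun _ => mu)) /=.
by rewrite big1 ?mul1r // => i _; rewrite mu_sum1.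
Qed.

Lemma expect_sum (J : Type) (s : seq J) (F : J -> {ffun I -> T} -> R) :
  expect (fun g => \sum_(j <- s) F j g) = \sum_(j <- s) expect (F j).
Proof.
rewrite exchange_big; apply: eq_bigr => g _; by rewrite mulr_sumr.
Qed.

Definition upd g (i : I) (t : T) : {ffun I -> T} :=
  [ffun j => if j == i then t else g j].

(** Exchanging the i-th coordinate with an independent copy preserves the law and
    does not change F. *)
Lemma expect_indep (i : I) F h : (forall g t, F (upd g i t) = F g) ->
  expect (fun g => F g * h (g i)) = expect F * mean h.
Proof.
move=> Fi.
pose swap (p : {ffun I -> T} * T) := (upd p.1 i p.2, p.1 i).
have swapK : involutive swap.
  move=> [g t]; rewrite /swap /= !ffunE eqxx; congr (_, _).
  by apply/ffunP => j; rewrite !ffunE; case: eqP => // ->.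
have prod_upd g t : (\prod_j mu (upd g i t j)) * mu (g i) = (\prod_j mu (g j)) * mu t.
  rewrite (bigD1 i) //= [in RHS](bigD1 i) //= ffunE eqxx.
  rewrite (eq_bigr (fun j => mu (g j))) => [|j ji]; last by rewrite ffunE (negbTE ji).
  by ring.
transitivity (\sum_(p : {ffun I -> T} * T)
    (\prod_j mu (p.1 j)) * mu p.2 * (F p.1 * h (p.1 i))).
  rewrite -(pair_bigA _ (fun g t => (\prod_j mu (g j)) * mu t * (F g * h (g i)))) /=.
  apply: eq_bigr => g _; rewrite -mulr_suml -mulr_sumr mu_sum1 mulr1 //.
rewrite (reindex_inj (inv_inj swapK)) /=.
rewrite /expect /mean mulr_suml.
rewrite -(pair_bigA _ (fun g t => (\prod_j mu (upd g i t j)) * mu (g i)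
  * (F (upd g i t) * h (upd g i t i)))) /=.
apply: eq_bigr => g _; rewrite mulr_sumr; apply: eq_bigr => t _.
by rewrite prod_upd Fi ffunE eqxx; ring.
Qed.

Lemma expect_coord (i : I) h : expect (fun g => h (g i)) = mean h.
Proof.
have := @expect_indep i (fun=> 1) h (fun _ _ => erefl).
rewrite expect_cst mul1r => <-.
by apply: eq_bigr => g _; rewrite mul1r.
Qed.

Section walk.
Variables (J : nat) (idx : nat -> I).
Hypothesis idx_inj : {in [pred j | (j < J)%N] &, injective idx}.

(** The multiplicative walk reads the coordinates in the order [idx]; [J] bounds
    the range where no coordinate is read twice. *)
Definition walk h (j : nat) g : R := \prod_(t < j) h (g (idx t)).

Fixpoint walk_max h (j : nat) g : R :=
  if j is j'.+1 then Num.max (walk_max h j' g) (walk h j'.+1 g) else 1.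

Lemma walkS h j g : walk h j.+1 g = walk h j g * h (g (idx j)).
Proof. by rewrite /walk big_ord_recr. Qed.

Lemma walk_upd h j i g t : (j <= i)%N -> (i < J)%N ->
  walk h j (upd g (idx i) t) = walk h j g.
Proof.
move=> ji iJ; apply: eq_bigr => s _; rewrite ffunE; case: eqP => // si.
have sj := ltn_ord s; have /idx_inj : idx s = idx i by [].
by rewrite !inE => /(_ (leq_trans sj (leq_trans ji (ltnW iJ))) iJ) E; lia.
Qed.

Lemma walk_max_upd h j i g t : (j <= i)%N -> (i < J)%N ->
  walk_max h j (upd g (idx i) t) = walk_max h j g.
Proof.
elim: j => //= j IH ji iJ; rewrite IH ?walk_upd //; exact: ltnW.
Qed.

Lemma expect_walk h j : (j <= J)%N -> expect (walk h j) = mean h ^+ j.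
Proof.
elim: j => [|j IH] jJ.
  rewrite -[RHS](expect_cst 1); apply: eq_bigr => g _; by rewrite /walk big_ord0.
rewrite exprSr -(IH (ltnW jJ)).
transitivity (expect (fun g => walk h j g * h (g (idx j)))).
  by apply: eq_bigr => g _; rewrite walkS.
by apply: expect_indep => g t; exact: walk_upd.
Qed.

Lemma walk_max_ge1 h j g : 1 <= walk_max h j g.
Proof. by elim: j => //= j IH; rewrite le_max IH. Qed.

Lemma walk_max_ge h j l g : (l <= j)%N -> walk h l g <= walk_max h j g.
Proof.
elim: j => [|j IH]; first by rewrite leqn0 => /eqP->; rewrite /walk big_ord0.
rewrite leq_eqVlt => /orP[/eqP->|lj] /=; first by rewrite le_max lexx orbT.
by rewrite le_max IH.
Qed.

(** Doob's L2 inequality, by Burkholder's method: with M the running maximum (at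
    least 1) and Y the walk, the process M (M - 2 Y) starts at -1 and has
    nonpositive drift because E h >= 1, while
    M^2 <= 4 Y^2 + 2 M (M - 2 Y) holds pointwise. *)
Lemma doob h j : (forall t, 0 <= h t) -> 1 <= mean h -> (j <= J)%N ->
  expect (fun g => walk_max h j g ^+ 2) <= 4 * mean (fun t => h t ^+ 2) ^+ j.
Proof.
move=> h0 h1 jJ.
pose U (j : nat) g := walk_max h j g * (walk_max h j g - 2 * walk h j g).
have EU i : (i <= J)%N -> expect (U i) <= 0.
  elim: i => [|i IH] iJ.
    rewrite -[leRHS](expect_cst 0); apply: expect_le => g.
    by rewrite /U /= /walk big_ord0; lra.
  apply: le_trans (IH (ltnW iJ)).
  apply: (@le_trans _ _ (expect (fun g => walk_max h i g ^+ 2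
      + (-2) * (walk_max h i g * walk h i g * h (g (idx i)))))).
    apply: expect_le => g; rewrite /U /= walkS -[X in (- 2) * X]mulrA.
    set m := walk_max h i g; set y := walk h i g * _.
    have := sqr_ge0 (m - y); have [ym|my] := leP y m; rewrite !expr2; nra.
  rewrite expectD expectZ expect_indep; last first.
    by move=> g t; rewrite walk_max_upd // walk_upd.
  have -> : expect (U i) = expect (fun g => walk_max h i g ^+ 2)
      + (-2) * expect (fun g => walk_max h i g * walk h i g).
    rewrite -expectZ -expectD; apply: eq_bigr => g _; rewrite /U; ring.
  rewrite lerD2l.
  have : 0 <= expect (fun g => walk_max h i g * walk h i g).
    rewrite -[leLHS](expect_cst 0); apply: expect_le => g.
    rewrite mulr_ge0 //; first exact: le_trans (walk_max_ge1 _ _ _).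
    by apply: prodr_ge0.
  by nra.
have -> : mean (fun t => h t ^+ 2) ^+ j = expect (fun g => walk h j g ^+ 2).
  rewrite -expect_walk //; apply: eq_bigr => g _; congr (_ * _).
  by rewrite /walk prodrXl.
rewrite -expectZ.
apply: (@le_trans _ _ (expect (fun g => 4 * walk h j g ^+ 2 + 2 * U j g))).
  apply: expect_le => g; rewrite /U.
  set m := walk_max h j g; set y := walk h j g.
  by have := sqr_ge0 (m - 2 * y); rewrite !expr2; nra.
rewrite expectD (expectZ 2) -[leRHS]addr0 lerD2l.
by rewrite pmulr_rle0 //; exact: EU.
Qed.

End walk.
End iid.

(** * Deviations of all the cyclic windows *)

(** The tangent of the logarithm at [c]. It serves to bound an expected logarithm
    by the logarithm of a bound on the expectation. *)
Lemma ln_le_tangent (R : realType) (x c : R) :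
  0 < x -> 0 < c -> ln x <= x / c + ln c - 1.
Proof.
move=> x0 c0; have := expR_ge1Dx (ln x - ln c).
by rewrite -ln_div ?posrE // lnK ?posrE ?divr_gt0 // ln_div ?posrE //; lra.
Qed.

Section windows.
Variables (R : realType) (r : nat) (T : finType) (mu X : T -> R).
Hypotheses (mu_ge0 : forall t, 0 <= mu t) (mu_sum1 : \sum_t mu t = 1).
Implicit Type g : {ffun 'I_r.+1 -> T}.

Definition window g (i k : nat) : R := \sum_(t < k) X (g (inZp (i + t))).

Let m := mean mu X.

Let tilt (l : R) (t : T) : R := expR (l * (X t - m)).

Lemma mean_tilt_ge1 l : 1 <= mean mu (tilt l).
Proof.
have -> : 1 = mean mu (fun t => 1 + l * (X t - m)) :> R.
  rewrite /mean; under [RHS]eq_bigr do rewrite mulrDr mulr1 mulrCA mulrBr.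
  rewrite big_split /= mu_sum1 -mulr_sumr sumrB -mulr_suml mu_sum1 mul1r.
  by rewrite subrr mulr0 addr0.
by apply: ler_sum => t _; rewrite ler_wpM2l // expR_ge1Dx.
Qed.

Section blocks.
Variables (k B : nat) (l rho : R).
Hypotheses (k0 : (0 < k)%N) (kr : (k.*2 <= r.+1)%N) (rB : (r.+1 <= B * k)%N).
Hypotheses (l0 : 0 < l) (rho1 : 0 < rho).
Hypotheses (rhoP : mean mu (tilt l) <= rho) (rhoN : mean mu (tilt (- l)) <= rho).

Let idx (a t : nat) : 'I_r.+1 := inZp (a * k + t).

Let idx_inj a : {in [pred j | (j < k.*2)%N] &, injective (idx a)}.
Proof.
move=> i j; rewrite !inE => ik jk /(congr1 val) /= /eqP; rewrite eqn_modDl.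
by rewrite !modn_small ?(leq_trans ik) ?(leq_trans jk) // => /eqP.
Qed.

(* Half the tilt, since Doob's inequality bounds the mean of a square. *)
Let Z (s : R) g : R := \sum_(a < B) walk_max (idx a) (tilt (s / 2)) k.*2 g ^+ 2.

Let C : R := 4 * B%:R * rho ^+ k.*2.

Let B0 : (0 < B)%N.
Proof. by case: (B) rB. Qed.

Let C0 : 0 < C.
Proof. by rewrite /C !mulr_gt0 ?exprn_gt0 // ltr0n. Qed.

Let expect_Z s : mean mu (tilt s) <= rho -> expect mu (Z s) <= C.
Proof.
move=> srho; rewrite /Z expect_sum.
apply: (@le_trans _ _ (\sum_(a < B) 4 * rho ^+ k.*2)); last first.
  by rewrite sumr_const card_ord /C -mulr_natr; lra.
apply: ler_sum => a _.
apply: le_trans (doob mu_ge0 mu_sum1 (@idx_inj a) _ (mean_tilt_ge1 _) (leqnn _)) _.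
  by move=> t; exact: expR_ge0.
rewrite ler_wpM2l // lerXn2r ?nnegrE ?(ltW rho1) //.
  by apply: sumr_ge0 => t _; rewrite mulr_ge0 // sqr_ge0.
apply: le_trans srho; apply: ler_sum => t _.
rewrite ler_wpM2l // /tilt -expRM_natl ler_expR.
by rewrite mulrA mulrCA mulfV // mulr1.
Qed.

Let walk_tilt s a j g :
  walk (idx a) (tilt (s / 2)) j g ^+ 2
  = expR (s * (window g (a * k) j - j%:R * m)).
Proof.
rewrite /walk /tilt -expR_sum -expRM_natl; congr expR.
rewrite -mulr_sumr sumrB sumr_const card_ord -mulr_natl -/(window g (a * k) j).
by field.
Qed.

Let Z_gt0 s g : 0 < Z s g.
Proof.
apply: (@lt_le_trans _ _ (\sum_(a < B) 1)).
  by rewrite sumr_const card_ord ltr0n.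
by apply: ler_sum => a _; rewrite exprn_ege1 // walk_max_ge1.
Qed.

Let dev_le s a j g : (a < B)%N -> (j <= k.*2)%N ->
  s * (window g (a * k) j - j%:R * m) <= ln (Z s g).
Proof.
move=> aB jk; rewrite -ler_expR lnK ?posrE ?Z_gt0 // -walk_tilt.
rewrite /Z (bigD1 (Ordinal aB)) //=.
rewrite -[leLHS]addr0 lerD ?sumr_ge0 // => [|b _]; last exact: sqr_ge0.
rewrite lerXn2r ?nnegrE ?walk_max_ge //.
  by apply: prodr_ge0 => t _; exact: expR_ge0.
exact: le_trans (walk_max_ge1 _ _ _ _).
Qed.

(** Every window starts in one of B blocks of length [k], and is the difference of
    two partial sums of the walk of length 2k that starts with that block.
    Hence exp (l |deviation|) is at most the product of the sums over all
    blocks of the squared maxima of the tilted walks, for [l] and for [- l]. *)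
Lemma window_deviation : exists2 D : {ffun 'I_r.+1 -> T} -> R,
  expect mu D <= 2 * ln C &
  forall g i, l * `|window g i k - k%:R * m| <= D g.
Proof.
(* Tangents at C of the logarithms of the two sums, each of mean at most C. *)
exists (fun g => C^-1 * (Z l g + Z (- l) g) + (2 * ln C - 2)).
  rewrite expectD // expect_cst // expectZ // expectD //.
  have : C^-1 * (expect mu (Z l) + expect mu (Z (- l))) <= 2%:R.
    by rewrite ler_pdivrMl // mulr_natr mulr2n lerD // expect_Z.
  lra.
move=> g i; rewrite -[l in leLHS]gtr0_norm // -normrM.
have -> : window g i k = window g (i %% r.+1) k.
  apply: eq_bigr => t _; congr (X (g _)); apply: val_inj => /=.
  by rewrite modnDml.
move: (i %% r.+1)%N (ltn_pmod i (ltn0Sn r)) => {}i ir.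
pose a := (i %/ k)%N; pose i' := (i %% k)%N.
have i'k : (i' < k)%N by exact: ltn_pmod.
have aB : (a < B)%N by rewrite ltn_divLR // (leq_trans ir).
have -> : window g i k = window g (a * k) (i' + k) - window g (a * k) i'.
  rewrite /window big_split_ord /= addrC addrK; apply: eq_bigr => t _.
  by rewrite addnA -divn_eq.
have [h1 h2] : ((i' + k <= k.*2) /\ (i' <= k.*2))%N by lia.
have := dev_le l g aB h1; have := dev_le (- l) g aB h1.
have := dev_le l g aB h2; have := dev_le (- l) g aB h2.
rewrite natrD; set u := window _ _ _; set v := window _ _ _.
have := ln_le_tangent (Z_gt0 l g) C0; have := ln_le_tangent (Z_gt0 (- l) g) C0.
set Zp := Z l g; set Zm := Z (- l) g; rewrite ![_ / C]mulrC.
by rewrite ler_norml; lra.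
Qed.

End blocks.
End windows.

(** * Truncated geometric gaps *)

(** The bound is the moment generating function of the exponential law of mean 1,
    the limit of the scaled geometric laws. *)
Lemma geometric_mgf (R : realType) (M : nat) (q s : R) : 0 < q < 1 -> s < 1 ->
  \sum_(j < M) q * (1 - q) ^+ j * expR (s * (q * j.+1%:R)) <= (1 - s)^-1.
Proof.
move=> /andP[q0 q1] s1.
set y := expR (s * q); set v := (1 - q) * y.
have y0 : 0 < y by exact: expR_gt0.
have y1 : y * (1 - s * q) <= 1.
  have := expR_ge1Dx (- (s * q)); rewrite expRN => /(ler_wpM2l (ltW y0)).
  by rewrite divff ?gt_eqF.
have v0 : 0 <= v by rewrite mulr_ge0 ?subr_ge0 ?ltW.
set S := \sum_(j < M) v ^+ j.
have S0 : 0 <= S by apply: sumr_ge0 => j _; exact: exprn_ge0.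
have S1 : (1 - v) * S <= 1.
  have eS := subrX1 v M; have := exprn_ge0 M v0.
  by rewrite -/S in eS; move: eS; rewrite mulrBl mul1r; lra.
have -> : \sum_(j < M) q * (1 - q) ^+ j * expR (s * (q * j.+1%:R)) = q * y * S.
  rewrite mulr_sumr; apply: eq_bigr => j _.
  have -> : expR (s * (q * j.+1%:R)) = y ^+ j.+1 by rewrite mulrA mulrC expRM_natl.
  by rewrite /v exprMn exprS; ring.
rewrite -[(1 - s)^-1]mul1r ler_pdivlMr ?subr_gt0 //.
apply: le_trans S1.
have -> : q * y * S * (1 - s) = (q * y * (1 - s)) * S by ring.
by rewrite ler_wpM2r // /v; nra.
Qed.

Lemma geometric_mean (R : realType) (M : nat) (q : R) :
  \sum_(j < M) q * (1 - q) ^+ j * (q * j.+1%:R) = 1 - (1 + M%:R * q) * (1 - q) ^+ M.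
Proof.
elim: M => [|M IH]; first by rewrite big_ord0 expr0; ring.
by rewrite big_ord_recr /= IH exprS -!natr1; ring.
Qed.

Lemma pos_window (M r : nat) (g : {ffun 'I_r.+1 -> 'I_M}) (i k : nat) :
  (pos g (i + k) - pos g i)%N = (\sum_(t < k) gap g (i + t))%N.
Proof. by rewrite /pos big_split_ord /= addKn. Qed.

Section lower.
Variables (R : realType) (M r K n0 k B : nat) (q c l : R).
Hypotheses (q01 : 0 < q < 1) (c0 : 0 <= c) (Kr : (K <= r)%N) (M0 : (0 < M)%N).
Hypothesis turan_le : forall n, (n0 <= n)%N ->
  (turan_number r.+1 n (Hgraph K.+2 r.+1))%:R <= c * 'C(n, r.+1)%:R.
Hypotheses (k0 : (0 < k)%N) (kr : (k.*2 <= r.+1)%N) (rB : (r.+1 <= B * k)%N).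
Hypothesis (Kk : (K = k) \/ (K + k = r.+1)%N).
Hypotheses (l0 : 0 < l) (l1 : l <= 1 / 2).

Let th : R := (1 - q) ^+ M.
Let m : R := (1 - (1 + M%:R * q) * th) / (1 - th).
Let rho : R := (1 - th)^-1 * expR (l * (1 - m) + 2 * l ^+ 2).
Let mu (j : 'I_M) : R := (1 - th)^-1 * (q * (1 - q) ^+ j).
Let X (j : 'I_M) : R := q * j.+1%:R.

Let th0 : 0 <= th.
Proof. by case/andP: q01 => *; rewrite exprn_ge0 // subr_ge0 ltW. Qed.

Let th1 : 0 < 1 - th.
Proof.
case/andP: q01 => q0 q1; rewrite subr_gt0 exprn_ilt1 -?lt0n // ?subr_ge0 ?ltW //.
by rewrite gtrBl.
Qed.

Let mu_ge0 j : 0 <= mu j.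
Proof. by apply: mulr_ge0; [rewrite invr_ge0 ltW|exact: weight_ge0]. Qed.

Let mu_sum1 : \sum_j mu j = 1.
Proof. by rewrite -mulr_sumr sum_weight mulVf // gt_eqF. Qed.

Let meanX : mean mu X = m.
Proof.
rewrite /mean /mu; under eq_bigr do rewrite -mulrA.
by rewrite -mulr_sumr geometric_mean mulrC.
Qed.

Let m1 : m <= 1.
Proof.
rewrite ler_pdivrMr // mul1r; have : 0 <= M%:R * q * th.
  by rewrite !mulr_ge0 //; case/andP: q01 => *; exact: ltW.
by lra.
Qed.

Let tilt_le s : `|s| <= l -> mean mu (fun t => expR (s * (X t - mean mu X))) <= rho.
Proof.
move=> sl; have sh := le_trans sl l1.
have : -(1/2) <= s <= 1/2 by rewrite -ler_norml.
case/andP=> s1 s2.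
have -> : mean mu (fun t => expR (s * (X t - mean mu X)))
   = (1 - th)^-1 * (expR (- (s * m))
       * \sum_(j < M) q * (1 - q) ^+ j * expR (s * (q * j.+1%:R))).
  rewrite meanX /mean !mulr_sumr; apply: eq_bigr => j _.
  by rewrite mulrBr expRD /mu /X; ring.
rewrite /rho ler_wpM2l ?invr_ge0 ?(ltW th1) //.
have mgf := geometric_mgf M q01 (_ : s < 1).
apply: le_trans (ler_wpM2l (expR_ge0 _) (mgf _)) _; first by lra.
(* (1 + s + 2 s^2) (1 - s) = 1 + s^2 (1 - 2 s), and s <= 1/2. *)
have inv_le : (1 - s)^-1 <= expR (s + 2 * s ^+ 2).
  rewrite -[leLHS]mul1r ler_pdivrMr; last lra.
  apply: (@le_trans _ _ ((1 + (s + 2 * s ^+ 2)) * (1 - s))); last first.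
    by rewrite ler_wpM2r ?expR_ge1Dx //; lra.
  by rewrite expr2; nra.
apply: le_trans (ler_wpM2l (expR_ge0 _) inv_le) _.
rewrite -expRD ler_expR.
have h1 : s ^+ 2 <= l ^+ 2.
  by rewrite -[s ^+ 2]real_normK ?num_real // lerXn2r ?nnegrE // ltW.
have h2 : s * (1 - m) <= l * (1 - m).
  by rewrite ler_wpM2r ?subr_ge0 // (le_trans (ler_norm s)).
lra.
Qed.

Let rho0 : 0 < rho.
Proof. by rewrite mulr_gt0 ?invr_gt0 ?expR_gt0. Qed.

Let q_pos (g : {ffun 'I_r.+1 -> 'I_M}) i j :
  q * (pos g (i + j) - pos g i)%:R = window X g i j.
Proof. by rewrite pos_window natr_sum mulr_sumr. Qed.

(** Any window of K gaps is either a window of k gaps or the complement of one in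
    the whole cycle; the expected total is known exactly. *)
Lemma expect_min_window :
  K%:R * m - 2 * ln (4 * B%:R * rho ^+ k.*2) / l
  <= expect mu (fun g : {ffun 'I_r.+1 -> 'I_M} => q * (min_window K g)%:R).
Proof.
have rhoN : mean mu (fun t => expR (- l * (X t - mean mu X))) <= rho.
  by apply: tilt_le; rewrite normrN gtr0_norm.
have rhoP : mean mu (fun t => expR (l * (X t - mean mu X))) <= rho.
  by apply: tilt_le; rewrite gtr0_norm.
have [D ED Dle] := window_deviation mu_ge0 mu_sum1 k0 kr rB l0 rho0 rhoP rhoN.
(* The part of the window that does not come from the deviation of a k-window. *)
pose tot (g : {ffun 'I_r.+1 -> 'I_M}) : R :=
  if K == k then K%:R * m else window X g 0 r.+1 - k%:R * m.
have Etot : expect mu tot = K%:R * m.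
  rewrite /tot; case: eqP Kk => [_ _|Kk' []//kK].
    by rewrite expect_cst.
  rewrite expectD // expect_cst // /window expect_sum.
  under eq_bigr do rewrite expect_coord //.
  by rewrite sumr_const card_ord meanX -[m *+ _]mulr_natl -kK natrD; ring.
apply: (@le_trans _ _ (expect mu (fun g => tot g + (- l^-1) * D g))).
  rewrite expectD // expectZ // Etot lerD2l mulNr lerN2 [leLHS]mulrC.
  by rewrite ler_wpM2r // invr_ge0 ltW.
apply: expect_le => // g.
have [i ->] : exists i, min_window K g = (pos g (i + K) - pos g i)%N.
  by rewrite /min_window; eexists; reflexivity.
have dev j : - (l^-1 * D g) <= window X g j k - k%:R * m <= l^-1 * D g.
  by rewrite -ler_norml ler_pdivlMl // -meanX.
rewrite mulNr /tot; case: eqP Kk => [Kk' _|Kk' []//kK].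
  rewrite q_pos Kk'; have /andP[] := dev i; lra.
have := congr1 (fun n => q * n%:R) (pos_complement g i kK).
have := q_pos g 0 r.+1; rewrite add0n pos0 subn0 => ->.
by rewrite natrD mulrDr !q_pos; have /andP[] := dev (i + K)%N; lra.
Qed.

(** Dividing each geometric weight by the probability 1 - th that the gap is not
    cut off turns the weighted sum into an expectation. *)
Lemma turan_lower_finite :
  (1 - th) ^+ r.+1 * (K%:R * m - 2 * ln (4 * B%:R * rho ^+ k.*2) / l)
  <= q * n0%:R + c * r.+1%:R.
Proof.
apply: le_trans (geometric_min_window M q01 c0 Kr turan_le).
apply: le_trans (ler_wpM2l (exprn_ge0 _ (ltW th1)) expect_min_window) _.
rewrite expectZ mulrCA /expect !mulr_sumr; apply: ler_sum => g _.
have -> : \prod_i mu (g i) = ((1 - th) ^+ r.+1)^-1 * \prod_i (q * (1 - q) ^+ (g i)).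
  by rewrite /mu big_split /= prodr_const card_ord exprVn.
rewrite le_eqVlt; apply/orP; left; apply/eqP; field.
by rewrite expf_neq0 // gt_eqF.
Qed.

End lower.

Local Open Scope classical_set_scope.

(** * The continuous limit *)

Section limit.
Variable R : realType.

(** Parameters for which the truncation point, the square of 1 / rate, is far
    beyond the typical gap 1 / rate. *)
Definition rate (N : nat) : R := N.+2%:R^-1.
Definition tail (N : nat) : R := (1 - rate N) ^+ (N.+2 ^ 2).

Lemma rate01 N : 0 < rate N < 1.
Proof. by rewrite invr_gt0 ltr0n invf_lt1 ?ltr0n // ltr1n. Qed.

Lemma rate_cvg : rate N @[N --> \oo] --> (0 : R).
Proof.
have := @cvg_harmonic R; rewrite -(cvg_shiftS (@harmonic R)).
exact.
Qed.

Lemma tail_ge0 N : 0 <= tail N.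
Proof. by have /andP[? ?] := rate01 N; rewrite exprn_ge0 // subr_ge0 ltW. Qed.

Lemma tail_le N : N.+2%:R * tail N <= 4 * rate N.
Proof.
have /andP[q0 q1] := rate01 N; set n : R := N.+2%:R.
have n0 : 0 < n by rewrite ltr0n.
have nq : n * rate N = 1 by rewrite mulfV // gt_eqF.
(* tail = (1 - 1/n)^(n^2) <= exp(-n) <= 4 / n^2. *)
have h1 : tail N <= expR (- n).
  apply: (@le_trans _ _ (expR (- rate N) ^+ (N.+2 ^ 2))).
    by rewrite lerXn2r ?nnegrE ?expR_ge0 ?subr_ge0 ?(ltW q1) // expR_ge1Dx.
  rewrite -expRM_natl ler_expR natrX -/n expr2.
  have -> : n * n * (- rate N) = - (n * (n * rate N)) by ring.
  by rewrite nq mulr1.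
have h2 : n ^+ 2 * expR (- n) <= 4.
  have -> : expR (- n) = expR (- (n / 2)) ^+ 2.
    by rewrite -expRM_natl; congr expR; field.
  have h : n / 2 * expR (- (n / 2)) <= 1.
    rewrite expRN ler_pdivrMr ?expR_gt0 // mul1r.
    by apply: le_trans (expR_ge1Dx _); rewrite lerDr.
  have h0 : 0 <= n / 2 * expR (- (n / 2)) by rewrite mulr_ge0 ?expR_ge0 // divr_ge0 // ltW.
  have -> : n ^+ 2 * expR (- (n / 2)) ^+ 2 = 4 * (n / 2 * expR (- (n / 2))) ^+ 2 by field.
  by rewrite -[leRHS]mulr1 ler_wpM2l // exprn_ile1.
rewrite ler_pdivlMr // mulrAC -expr2.
by apply: le_trans h2; rewrite ler_wpM2l // sqr_ge0.
Qed.

Lemma mul_tail_cvg : N.+2%:R * tail N @[N --> \oo] --> (0 : R).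
Proof.
have h : (4 * rate N) @[N --> \oo] --> (4 * 0 : R).
  by apply: cvgMr; exact: rate_cvg.
rewrite mulr0 in h; apply: (squeeze_cvgr _ (cvg_cst 0) h).
by near=> N; rewrite mulr_ge0 ?tail_ge0 // tail_le.
Unshelve. all: by end_near. Qed.

Lemma tail_cvg : tail N @[N --> \oo] --> (0 : R).
Proof.
apply: (squeeze_cvgr _ (cvg_cst 0) mul_tail_cvg).
by near=> N; rewrite tail_ge0 ler_peMl ?tail_ge0 // ler1n.
Unshelve. all: by end_near. Qed.

(** The bound for finite parameters, passed to the limit, for every admissible
    tilt [l] and number [B] of blocks. *)
Lemma turan_density_lower (K r k B : nat) (l : R) :
  (K <= r)%N -> (0 < k)%N -> (k.*2 <= r.+1)%N -> (r.+1 <= B * k)%N ->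
  (K = k) \/ (K + k = r.+1)%N -> 0 < l -> l <= 1 / 2 ->
  K%:R - 2 * (ln (4 * B%:R) + 4 * k%:R * l ^+ 2) / l
  <= r.+1%:R * turan_density R r.+1 (Hgraph K.+2 r.+1).
Proof.
move=> Kr k0 kr rB Kk l0 l1; set p := turan_density _ _ _.
have B0 : (0 < B)%N by case: (B) rB.
have p0 : 0 <= p by exact: turan_density_ge0.
apply/ler_addgt0Pr => e e0.
(* The Turan ratio is eventually at most this c. *)
pose c := p + e / r.+1%:R.
have c0 : 0 <= c by rewrite addr_ge0 // divr_ge0 // ltW.
have -> : r.+1%:R * p + e = 0 * 0 + c * r.+1%:R.
  by rewrite /c; field; rewrite addrC natr1 pnatr_eq0.
have [n0 turan_le] : exists n0, forall n, (n0 <= n)%N ->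
    (turan_number r.+1 n (Hgraph K.+2 r.+1))%:R <= c * 'C(n, r.+1)%:R.
  have /cvgrPdist_le := @turan_ratio_cvg R _ r.+1 (Hgraph K.+2 r.+1).
  move=> /(_ (e / r.+1%:R)); rewrite divr_gt0 ?ltr0n // => /(_ isT)[n0 _ h].
  exists n0 => n /h /=; rewrite ler_norml => /andP[h1 _].
  have [nr|rn] := ltnP n r.+1.
    have := turan_number_le_bin r.+1 n (Hgraph K.+2 r.+1).
    by rewrite bin_small // leqn0 => /eqP->; rewrite mulr0.
  rewrite -ler_pdivrMr ?ltr0n ?bin_gt0 //.
  by move: h1; rewrite lerBrDr addrC -lerBrDr opprK.
pose m N : R := (1 - (1 + (N.+2 ^ 2)%:R * rate N) * tail N) / (1 - tail N).
pose rho N : R := (1 - tail N)^-1 * expR (l * (1 - m N) + 2 * l ^+ 2).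
have q_cvg := rate_cvg; have t_cvg := tail_cvg.
have u_cvg : 1 - tail N @[N --> \oo] --> (1 : R).
  by rewrite -[X in _ --> X]subr0; apply: cvgB => //; exact: cvg_cst.
have m_cvg : m N @[N --> \oo] --> (1 : R).
  have -> : (1 : R) = (1 - (0 + 0)) / 1 by rewrite addr0 subr0 divr1.
  apply: cvgM; last by apply: cvgV => //; exact: oner_neq0.
  apply: cvgB; first exact: cvg_cst.
  have -> : (fun N => (1 + (N.+2 ^ 2)%:R * rate N) * tail N)
     = (fun N => tail N + N.+2%:R * tail N).
    apply/funext => N; rewrite natrX /rate; field.
    by rewrite -natrD pnatr_eq0.
  by apply: cvgD => //; exact: mul_tail_cvg.
have rho_cvg : rho N @[N --> \oo] --> expR (2 * l ^+ 2).
  have -> : expR (2 * l ^+ 2) = 1^-1 * expR (l * (1 - 1) + 2 * l ^+ 2).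
    by rewrite invr1 mul1r subrr mulr0 add0r.
  apply: cvgM; first by apply: cvgV => //; exact: oner_neq0.
  apply: continuous_cvg; first exact: continuous_expR.
  apply: cvgD; last exact: cvg_cst.
  by apply: cvgMr; apply: cvgB => //; exact: cvg_cst.
have rhs_cvg : rate N * n0%:R + c * r.+1%:R @[N --> \oo] --> (0 * n0%:R + c * r.+1%:R : R).
  by apply: cvgD; [exact: cvgMl|exact: cvg_cst].
have lhs_cvg :
    (1 - tail N) ^+ r.+1 * (K%:R * m N - 2 * ln (4 * B%:R * rho N ^+ k.*2) / l)
    @[N --> \oo] -->
    (1 ^+ r.+1 * (K%:R * 1
       - 2 * ln (4 * B%:R * expR (2 * l ^+ 2) ^+ k.*2) / l) : R).
  have X_cvg (f : nat -> R) (a : R) j : f N @[N --> \oo] --> a -> f N ^+ j @[N --> \oo] --> a ^+ j.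
    move=> fa; elim: j => [|j IH]; first exact: cvg_cst.
    by rewrite exprS; under eq_fun do rewrite exprS; exact: cvgM.
  apply: cvgM; first exact: X_cvg.
  apply: cvgB; first exact: cvgMr.
  apply: cvgMl; apply: cvgMr.
  apply: continuous_cvg; last by apply: cvgMr; exact: X_cvg.
  by apply: continuous_ln; rewrite !mulr_gt0 ?exprn_gt0 ?expR_gt0 // ltr0n.
have := ler_cvg_to lhs_cvg rhs_cvg.
rewrite expr1n mul1r mulr1 mul0r mul0r.
have -> : ln (4 * B%:R * expR (2 * l ^+ 2) ^+ k.*2) = ln (4 * B%:R) + 4 * k%:R * l ^+ 2.
  rewrite lnM ?posrE ?exprn_gt0 ?expR_gt0 ?mulr_gt0 ?ltr0n //.
  by rewrite -expRM_natl expRK -mul2n natrM; congr (_ + _); ring.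
apply; near=> N.
by apply: turan_lower_finite => //; rewrite ?rate01 ?expn_gt0.
Unshelve. all: by end_near. Qed.

End limit.

(** * Two-sided estimate of the density *)

(** The optimal tilt is l = sqrt (L / k); when it exceeds the range where the
    moment bounds hold, l = 1/2 costs only a multiple of L. *)
Lemma turan_density_lower_sqrt (R : realType) (K r k : nat) :
  (0 < K <= r)%N -> k = minn K (r.+1 - K) ->
  let L : R := ln (expR 1 * r.+1%:R / k%:R) in
  K%:R - 28 * (Num.sqrt (k%:R * L) + L)
  <= r.+1%:R * turan_density R r.+1 (Hgraph K.+2 r.+1).
Proof.
move=> /andP[K0 Kr] kE; set L := ln _; cbv zeta.
have k0 : (0 < k)%N by lia.
have kr : (k.*2 <= r.+1)%N by lia.
have Kk : (K = k) \/ (K + k = r.+1)%N by lia.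
(* Blocks of length k covering the cycle: at most 2 (r + 1) / k of them. *)
pose B := (r.+1 %/ k).+1.
have rB : (r.+1 <= B * k)%N by rewrite ltnW // ltn_ceil.
have Bk : (B * k <= 2 * r.+1)%N.
  by rewrite mulSn; have := leq_trunc_div r.+1 k; lia.
have kR : 0 < k%:R :> R by rewrite ltr0n.
set x : R := r.+1%:R / k%:R.
have x1 : 1 <= x by rewrite ler_pdivlMr // mul1r ler_nat; lia.
have x0 : 0 < x by apply: lt_le_trans x1.
have e0 : 0 < expR 1 :> R by exact: expR_gt0.
have e2 : 2 <= expR 1 :> R by apply: le_trans (expR_ge1Dx 1); lra.
have LE : expR L = expR 1 * x by rewrite /L -mulrA -/x lnK // posrE mulr_gt0.
have L1 : 1 <= L by rewrite -ler_expR LE ler_peMr // ltW.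
have lnB : ln (4 * B%:R) <= 3 * L.
  have B4 : 0 < 4 * B%:R :> R by rewrite mulr_gt0 // ltr0n.
  rewrite -ler_expR lnK ?posrE //.
  have -> : expR (3 * L) = (expR 1 * x) ^+ 3 by rewrite -LE -expRM_natl.
  apply: (@le_trans _ _ (8 * x)).
    have : B%:R * k%:R <= 2 * r.+1%:R :> R by rewrite -!natrM ler_nat.
    by rewrite /x mulrA ler_pdivlMr //; lra.
  apply: (@le_trans _ _ ((2 * x) ^+ 3)); last first.
    by rewrite lerXn2r ?nnegrE ?mulr_ge0 ?(ltW x0) ?(ltW e0) // ler_pM2r.
  rewrite exprMn; have -> : 2 ^+ 3 = 8 :> R by ring.
  rewrite ler_pM2l // -[leLHS]expr1 ler_weXn2l //.
have lower l : 0 < l -> l <= 1 / 2 -> K%:R - 2 * (3 * L + 4 * k%:R * l ^+ 2) / l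
   <= r.+1%:R * turan_density R r.+1 (Hgraph K.+2 r.+1).
  move=> l0 l1; apply: le_trans (turan_density_lower Kr k0 kr rB Kk l0 l1).
  by rewrite lerD2l lerN2 ler_pM2r ?invr_gt0 // ler_pM2l // lerD2r.
have L0 : 0 < L by lra.
set s := Num.sqrt (k%:R * L).
have s0 : 0 < s by rewrite sqrtr_gt0 mulr_gt0.
have s2 : s ^+ 2 = k%:R * L by rewrite sqr_sqrtr // mulr_ge0 ?ltW.
have [kL|Lk] := leP k%:R (4 * L).
  have h2 : 0 < 1 / 2 :> R by lra.
  apply: le_trans (lower (1 / 2) h2 (lexx _)).
  rewrite lerD2l lerN2.
  have -> : 2 * (3 * L + 4 * k%:R * (1 / 2) ^+ 2) / (1 / 2) = 12 * L + 4 * k%:R by field.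
  lra.
have sk : s / k%:R <= 1 / 2.
  rewrite ler_pdivrMr // -ler_sqr ?nnegrE ?(ltW s0) ?mulr_ge0 ?(ltW kR) ?divr_ge0 //.
  by rewrite s2 expr2; nra.
apply: le_trans (lower (s / k%:R) (divr_gt0 s0 kR) sk).
rewrite lerD2l lerN2.
have -> : 2 * (3 * L + 4 * k%:R * (s / k%:R) ^+ 2) / (s / k%:R) = 14 * s.
  have -> : L = s ^+ 2 / k%:R by rewrite s2 mulrC mulKf ?gt_eqF.
  by field; rewrite !gt_eqF.
lra.
Qed.

Section bounds.
Variables (R : realType) (k r : nat).
Hypotheses (r2 : (2 <= r)%N) (kr : (3 <= k <= r.+1)%N).

Let K : R := k%:R - 2.
Let p : R := turan_density R r (Hgraph k r).
Let m : R := Num.min K (r%:R - K).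

Lemma k_sub2_gt0 : 0 < K.
Proof. by rewrite subr_gt0 ltr_nat; case/andP: kr. Qed.

Lemma density_upper : r%:R * p <= K.
Proof.
rewrite /p /K; case: r kr r2 => // r' /andP[k3 _] _.
case: k k3 => [|[|K']] // _.
by apply: le_trans (turan_density_upper R K' r') _; rewrite -addn2 natrD addrK.
Qed.

Lemma density_lower (L := ln (expR 1 * r%:R / m)) :
  K - 28 * (Num.sqrt (m * L) + L) <= r%:R * p.
Proof.
rewrite /L /m /p /K; case: r kr r2 => // r' /andP[].
case: k => [|[|K']] // K3 K'r _.
have -> : K'.+2%:R - 2 = K'%:R :> R by rewrite -addn2 natrD addrK.
have -> : r'.+1%:R - K'%:R = (r'.+1 - K')%:R :> R by rewrite natrB //; lia.
rewrite -natr_min.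
apply: (@turan_density_lower_sqrt R K' r' (minn K' (r'.+1 - K'))) => //; lia.
Qed.

End bounds.

(** * Asymptotics *)

Section asymptotics.
Variables (R : realType) (k : nat -> nat).
Hypothesis hk : forall r : nat, (2 <= r)%N -> (3 <= k r <= r.+1)%N.

Local Notation K r := ((k r)%:R - 2 : R).
Local Notation p r := (turan_density R r (Hgraph (k r) r)).
Let m r : R := Num.min (K r) (r%:R - K r).
Let L r : R := ln (expR 1 * r%:R / m r).

Let K_gt0 r : (2 <= r)%N -> 0 < K r.
Proof. by move=> r2; exact: k_sub2_gt0 (hk r2). Qed.

Let r_gt0 r : (2 <= r)%N -> 0 < r%:R :> R.
Proof. by move=> r2; rewrite ltr0n; lia. Qed.

Let m_ge1 r : (2 <= r)%N -> 1 <= m r.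
Proof.
move=> r2; have /andP[k3 kr] := hk r2.
have : 3 <= (k r)%:R :> R by rewrite ler_nat.
have : (k r)%:R <= r%:R + 1 :> R by rewrite natr1 ler_nat.
by rewrite /m le_min => ? ?; apply/andP; split; lra.
Qed.

Let m_le_half r : 2 * m r <= r%:R.
Proof.
by rewrite /m; have [] := leP (K r) (r%:R - K r); lra.
Qed.

Let upper r : (2 <= r)%N -> r%:R * p r <= K r.
Proof. by move=> r2; exact: density_upper (hk r2). Qed.

Let lower r : (2 <= r)%N -> K r - 28 * (Num.sqrt (m r * L r) + L r) <= r%:R * p r.
Proof. by move=> r2; exact: density_lower (hk r2). Qed.

Let m_le_K r : m r <= K r.
Proof. by rewrite /m ge_min lexx. Qed.

Let ln_er r : (2 <= r)%N -> ln (expR 1 * r%:R) = 1 + ln r%:R :> R.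
Proof. by move=> /r_gt0 r0; rewrite lnM ?posrE ?expR_gt0 // expRK. Qed.

Let L_le r : (2 <= r)%N -> L r <= 1 + ln r%:R.
Proof.
move=> r2; have m0 : 0 < m r by apply: lt_le_trans (m_ge1 r2).
have er0 : 0 < expR 1 * r%:R :> R by rewrite mulr_gt0 ?expR_gt0 ?r_gt0.
rewrite -ln_er // ler_ln ?posrE ?divr_gt0 // ler_pdivrMr //.
by rewrite ler_peMr ?m_ge1 // ltW.
Qed.

Let L_ge1 r : (2 <= r)%N -> 1 <= L r.
Proof.
move=> r2; have m0 : 0 < m r by apply: lt_le_trans (m_ge1 r2).
rewrite -[leLHS]expRK ler_ln ?posrE ?mulr_gt0 ?divr_gt0 ?expR_gt0 ?r_gt0 ?invr_gt0 //.
rewrite ler_pdivlMr // ler_pM2l ?expR_gt0 //.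
by have := m_le_half r; lra.
Qed.

Let lower_rel x r : (2 <= r)%N -> 0 <= x -> L r <= x * K r ->
  1 - 28 * (Num.sqrt x + x) <= r%:R * p r / K r.
Proof.
move=> r2 x0 Lx; have K0 := K_gt0 r2; have L1 := L_ge1 r2.
rewrite ler_pdivlMr //; apply: le_trans (lower r2).
have h : Num.sqrt (m r * L r) <= Num.sqrt x * K r.
  rewrite -[K r in leRHS]ger0_norm ?(ltW K0) // -sqrtr_sqr -sqrtrM //.
  apply: ler_wsqrtr; rewrite expr2 mulrA [leRHS]mulrC.
  by apply: ler_pM; rewrite ?m_le_K //; [have := m_ge1 r2; lra|lra].
nra.
Qed.

(** Eventually log(e r) <= (4 / c) K, which makes the relative error at most
    28 (2 / sqrt c + 4 / c). *)
Lemma density_log (c : R) : 0 < c ->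
  (k r)%:R / ln r%:R @[r --> \oo] --> c ->
  exists2 eps : nat -> R, eps r @[r --> \oo] --> (0 : R) &
    forall r : nat, (2 <= r)%N ->
      1 - 128 * (c `^ (- (1 / 2)) + c^-1) + eps r <= r%:R * p r / K r <= 1.
Proof.
move=> c0 kc; set A := 128 * _.
(* The slack in the inequality cut at 0: it is nonnegative for large r. *)
exists (fun r => Num.min 0 (r%:R * p r / K r - (1 - A))); last first.
  move=> r r2; apply/andP; split; last by rewrite ler_pdivrMr ?K_gt0 // mul1r upper.
  by rewrite -lerBrDl ge_min lexx orbT.
apply: cvg_near_cst.
near=> r.
have r2 : (2 <= r)%N by near: r; exact: nbhs_infty_ge.
apply/eqP; rewrite eq_le ge_min lexx /= le_min lexx /= subr_ge0.
(* Together with k >= (c / 2) log r this gives c (1 + log r) <= 4 (k - 2). *)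
have lnr : 1 + 8 / c <= ln r%:R.
  rewrite -ler_expR lnK ?posrE ?r_gt0 //.
  by near: r; exact: nbhs_infty_ger.
have ln0 : 0 < ln r%:R :> R by apply: lt_le_trans lnr; rewrite ltr_pwDl ?divr_ge0 ?ltW.
have kl : c / 2 * ln r%:R <= (k r)%:R.
  rewrite -ler_pdivlMr //; near: r.
  apply: (cvgr_ge _ kc); lra.
have x0 : 0 <= 4 / c by rewrite divr_ge0 // ltW.
apply: le_trans (lower_rel r2 x0 _).
  rewrite lerD2l lerN2 /A powRN div1r powR12_sqrt ?(ltW c0) //.
  have -> : Num.sqrt (4 / c) = 2 * (Num.sqrt c)^-1.
    rewrite sqrtrM // sqrtrV ?ltW //; congr (_ * _).
    by rewrite (_ : 4 = 2 ^+ 2) ?sqrtr_sqr ?ger0_norm //; ring.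
  have : 0 <= (Num.sqrt c)^-1 by rewrite invr_ge0 sqrtr_ge0.
  have : 0 <= c^-1 by rewrite invr_ge0 ltW.
  lra.
apply: le_trans (L_le r2) _.
rewrite mulrAC ler_pdivlMr //.
have : (1 + 8 / c) * c <= ln r%:R * c by rewrite ler_pM2r.
by rewrite mulrDl mul1r divfK ?gt_eqF //; lra.
Unshelve. all: by end_near. Qed.

Let sqrt_inv_cvg : Num.sqrt (r%:R^-1) @[r --> \oo] --> (0 : R).
Proof.
rewrite -[X in _ --> X]sqrtr0; apply: continuous_cvg; first exact: sqrt_continuous.
by rewrite -(cvg_shiftS (fun r => r%:R^-1 : R)); exact: cvg_harmonic.
Qed.

Let ln_le_sqrt r : (2 <= r)%N -> (1 + ln r%:R) / r%:R <= 3 * Num.sqrt (r%:R^-1) :> R.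
Proof.
move=> r2; have r0 := r_gt0 r2; set s : R := Num.sqrt r%:R.
have s0 : 0 < s by rewrite sqrtr_gt0.
have s2 : r%:R = s ^+ 2 :> R by rewrite sqr_sqrtr // ltW.
have s1 : 1 <= s by rewrite -[leLHS]sqrtr1 ler_sqrt // ler1n; lia.
have h : ln r%:R <= 2 * s :> R.
  rewrite s2 lnXn // mulr2n.
  by have := ln_le_tangent s0 (ltr01 : 0 < 1 :> R); rewrite ln1 divr1; lra.
rewrite sqrtrV ?(ltW r0) // -/s ler_pdivrMr // [in leRHS]s2.
have -> : 3 * s^-1 * s ^+ 2 = 3 * s by field; rewrite gt_eqF.
lra.
Qed.

(** If K <= r / 2 then L / K is at most 15 times the quantity that tends to 0 by
    assumption; otherwise it is at most 2 log(e r) / r. *)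
Lemma density_equiv :
  ln (expR 1 * r%:R / (k r)%:R) / (k r)%:R @[r --> \oo] --> (0 : R) ->
  exists2 eps : nat -> R, eps r @[r --> \oo] --> (0 : R) &
    forall r : nat, (2 <= r)%N -> p r = (1 + eps r) * (K r / r%:R).
Proof.
move=> a0; exists (fun r => r%:R * p r / K r - 1); last first.
  move=> r r2; have K0 := K_gt0 r2; have r0 := r_gt0 r2.
  by field; rewrite !gt_eqF.
pose x r : R := 15 * (ln (expR 1 * r%:R / (k r)%:R) / (k r)%:R) + 6 * Num.sqrt (r%:R^-1).
have xc : x r @[r --> \oo] --> (15 * 0 + 6 * 0 : R).
  by apply: cvgD; apply: cvgMr.
rewrite !mulr0 addr0 in xc.
have lc : - (28 * (Num.sqrt (x r) + x r)) @[r --> \oo] --> (- (28 * (Num.sqrt 0 + 0)) : R).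
  apply: cvgN; apply: cvgMr; apply: cvgD => //.
  by apply: continuous_cvg => //; exact: sqrt_continuous.
rewrite sqrtr0 addr0 mulr0 oppr0 in lc.
apply: (squeeze_cvgr _ lc (cvg_cst 0)).
near=> r.
have r2 : (2 <= r)%N by near: r; exact: nbhs_infty_ge.
have K0 := K_gt0 r2; have r0 := r_gt0 r2; have /andP[k3 kr] := hk r2.
have k0 : 0 < (k r)%:R :> R by rewrite ltr0n; lia.
apply/andP; split; last by rewrite subr_le0 ler_pdivrMr // mul1r upper.
pose l : R := ln (expR 1 * r%:R / (k r)%:R).
have ekr0 : 0 < expR 1 * r%:R / (k r)%:R :> R by rewrite !mulr_gt0 ?expR_gt0 ?invr_gt0.
have l_ge : 1 / 2 <= l.
  have := ln_le_tangent k0 r0.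
  have k1 : (k r)%:R / r%:R <= 3 / 2 :> R.
    rewrite ler_pdivrMr //.
    have : (k r)%:R <= r%:R + 1 :> R by rewrite natr1 ler_nat.
    have : 2 <= r%:R :> R by rewrite ler_nat.
    lra.
  rewrite /l ln_div ?posrE ?mulr_gt0 ?expR_gt0 // ln_er //; lra.
have sq0 : 0 <= Num.sqrt (r%:R^-1) :> R by exact: sqrtr_ge0.
have l0 : 0 <= l / (k r)%:R by rewrite divr_ge0 //; lra.
have x0 : 0 <= x r by rewrite /x -/l; lra.
suff h : L r <= x r * K r by have := lower_rel r2 x0 h; lra.
rewrite /x -/l; set y := Num.sqrt _ in sq0 *.
have [Kr|rK] := leP (K r) (r%:R - K r); last first.
  have := ln_le_sqrt r2; rewrite ler_pdivrMr // -/y => ly.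
  have yK : y * r%:R <= y * (2 * K r) by rewrite ler_wpM2l //; lra.
  have lK : 0 <= l / (k r)%:R * K r by rewrite mulr_ge0 // ltW.
  have := L_le r2; lra.
have mK : m r = K r by rewrite /m; apply/min_idPl.
have k3K : (k r)%:R <= 3 * K r.
  by have : 3 <= (k r)%:R :> R; [rewrite ler_nat|lra].
(* L exceeds l by at most log 3, since k <= 3 K, and l >= 1/2. *)
have ln3 : ln 3 <= 2 :> R.
  rewrite -[leRHS]expRK ler_ln ?posrE ?expR_gt0 //.
  have e2 : 2 <= expR 1 :> R by apply: le_trans (expR_ge1Dx 1); lra.
  have -> : expR 2 = expR 1 ^+ 2 :> R by rewrite -expRM_natl mulr1.
  by rewrite expr2; nra.
have Ll : L r <= ln 3 + l.
  rewrite -lnM ?posrE // /L mK; set E := expR 1 * _ in ekr0 *.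
  have E0 : 0 < E by rewrite mulr_gt0 ?expR_gt0.
  rewrite ler_ln ?posrE ?divr_gt0 ?mulr_gt0 ?invr_gt0 // ler_pdivrMr //.
  have -> : 3 * (E / (k r)%:R) * K r = E / (k r)%:R * (3 * K r) by ring.
  by rewrite mulrAC ler_pdivlMr // ler_pM2l.
have lK : l <= l / (k r)%:R * (3 * K r).
  by rewrite mulrAC ler_pdivlMr // ler_wpM2l //; lra.
have yK : 0 <= y * K r by rewrite mulr_ge0 // ltW.
lra.
Unshelve. all: by end_near. Qed.

(** Here m / r tends to beta. Eventually it lies between beta / 2 and 2 beta, so
    that m L <= 4 r beta log(e / beta), while L is bounded; the error is then
    at most 84 sqrt (beta log(e / beta)) / sqrt r. *)
Lemma density_linear (alpha beta : R) : 0 < alpha < 1 ->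
  beta = Num.min alpha (1 - alpha) ->
  (k r)%:R / r%:R @[r --> \oo] --> alpha ->
  exists2 eps : nat -> R, eps r @[r --> \oo] --> (0 : R) &
    forall r : nat, (2 <= r)%N ->
      0 <= K r / r%:R - p r
        <= (128 * Num.sqrt (beta * ln (expR 1 / beta)) + eps r) / Num.sqrt r%:R.
Proof.
move=> /andP[al0 al1] betaE ka; set l := ln _; set s := Num.sqrt _.
have [beta0 beta_al beta_1al] : [/\ 0 < beta, beta <= alpha & beta <= 1 - alpha].
  by rewrite betaE lt_min !ge_min !lexx orbT al0 subr_gt0 al1.
have e0 : 0 < expR 1 :> R by exact: expR_gt0.
have l1 : 1 <= l.
  rewrite -[leLHS]expRK /l ler_ln ?posrE ?divr_gt0 //.
  by rewrite ler_pdivlMr // ler_piMr ?(ltW e0) //; lra.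
have s0 : 0 < s by rewrite sqrtr_gt0 mulr_gt0 //; lra.
have sr0 r : (2 <= r)%N -> 0 < Num.sqrt r%:R :> R by move=> /r_gt0; rewrite sqrtr_gt0.
(* The excess of the error over 128 s cut at 0: it is negative for large r. *)
exists (fun r => Num.max 0 ((K r / r%:R - p r) * Num.sqrt r%:R - 128 * s)); last first.
  move=> r r2; have r0 := r_gt0 r2; apply/andP; split.
    by rewrite subr_ge0 ler_pdivlMr // mulrC upper.
  by rewrite ler_pdivlMr ?sr0 // -lerBlDl le_max lexx orbT.
apply: cvg_near_cst; near=> r.
have r2 : (2 <= r)%N by near: r; exact: nbhs_infty_ge.
have r0 := r_gt0 r2; have t0 := sr0 r r2; set t := Num.sqrt r%:R in t0 *.
have t2 : r%:R = t ^+ 2 by rewrite sqr_sqrtr // ltW.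
apply/eqP; rewrite eq_le le_max lexx /= ge_max lexx /= subr_le0 andbT.
have r_large : (2 * l / s) ^+ 2 + 8 / beta <= r%:R.
  by near: r; exact: nbhs_infty_ger.
have ka1 : alpha - beta / 4 <= (k r)%:R / r%:R.
  by near: r; apply: (cvgr_ge _ ka); lra.
have ka2 : (k r)%:R / r%:R <= alpha + beta / 4.
  by near: r; apply: (cvgr_le _ ka); lra.
have lt : 2 * l <= s * t.
  have ls0 : 0 <= 2 * l / s by rewrite divr_ge0 ?(ltW s0) //; lra.
  rewrite [s * t]mulrC -ler_pdivrMr // -ler_sqr ?nnegrE ?(ltW t0) //.
  by rewrite -t2; apply: le_trans r_large; rewrite lerDl divr_ge0 // ltW.
have r8 : 2 / r%:R <= beta / 4.
  rewrite ler_pdivrMr //.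
  have : 8 / beta <= r%:R by apply: le_trans r_large; rewrite lerDr sqr_ge0.
  by rewrite ler_pdivrMr //; lra.
have r8' : 0 <= 2 / r%:R :> R by rewrite divr_ge0 // ltW.
have mb : m r / r%:R = Num.min (K r / r%:R) (1 - K r / r%:R).
  by rewrite /m minr_pMl ?invr_ge0 ?(ltW r0) // [(r%:R - K r) / _]mulrBl divff // gt_eqF.
have KE : K r / r%:R = (k r)%:R / r%:R - 2 / r%:R by rewrite mulrBl.
have b_itv : beta / 2 <= m r / r%:R <= 2 * beta.
  rewrite mb KE le_min ge_min; apply/andP; split; first by apply/andP; split; lra.
  have [aE|aE] := leP alpha (1 - alpha).
    by apply/orP; left; move/min_idPl: aE; rewrite -betaE => bE; lra.
  by apply/orP; right; move/ltW/min_idPr: aE; rewrite -betaE => bE; lra.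
have Lb : L r = ln (expR 1 / (m r / r%:R)) by rewrite /L invf_div mulrA.
have low := lower r2.
have mE : m r = r%:R * (m r / r%:R) by rewrite mulrCA divff ?mulr1 // gt_eqF.
rewrite [m r]mE in low; move: Lb low b_itv {mb KE mE}.
move: (m r / r%:R) => b Lb low /andP[b1 b2].
have b0 : 0 < b by lra.
have L1 := L_ge1 r2.
have Ll : L r <= 2 * l.
  have e2 : 2 <= expR 1 :> R by apply: le_trans (expR_ge1Dx 1); lra.
  have -> : 2 * l = ln ((expR 1 / beta) ^+ 2) by rewrite lnXn ?divr_gt0 // mulr2n -/l; ring.
  rewrite Lb ler_ln ?posrE ?exprn_gt0 ?divr_gt0 // ler_pdivrMr // expr2.
  set E := expR 1 / beta; have eE : expR 1 = E * beta by rewrite divfK // gt_eqF.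
  have E2 : 2 <= E.
    by apply: le_trans e2 _; rewrite ler_pdivlMr // ler_piMr ?(ltW e0) //; lra.
  rewrite eE; nra.
have sq : Num.sqrt (r%:R * b * L r) <= t * (2 * s).
  rewrite -mulrA sqrtrM ?(ltW r0) // -/t ler_pM2l //.
  have -> : 2 * s = Num.sqrt (4 * (beta * l)).
    rewrite sqrtrM // -/s (_ : 4 = 2 ^+ 2) ?sqrtr_sqr ?ger0_norm //; ring.
  by rewrite ler_wsqrtr //; nra.
have -> : (K r / r%:R - p r) * t = (K r - r%:R * p r) / t.
  by rewrite t2; field; rewrite gt_eqF.
rewrite ler_pdivrMr //.
have := mulr_gt0 s0 t0; lra.
Unshelve. all: by end_near. Qed.

End asymptotics.

Theorem corollary1p5 (R : realType) (k : nat -> nat)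
    (hk : forall r : nat, (2 <= r)%N -> (3 <= k r <= r.+1)%N) :
  (* (i) *)
  (forall c : R, 0 < c ->
     (k r)%:R / ln r%:R @[r --> \oo] --> c ->
     exists2 eps : nat -> R, eps r @[r --> \oo] --> (0 : R) &
       forall r : nat, (2 <= r)%N ->
         1 - 128 * (c `^ (- (1 / 2)) + c^-1) + eps r
           <= r%:R * turan_density R r (Hgraph (k r) r) / ((k r)%:R - 2)
           <= 1)
  /\
  (* (ii) *)
  (ln (expR 1 * r%:R / (k r)%:R) / (k r)%:R @[r --> \oo] --> (0 : R) ->
     exists2 eps : nat -> R, eps r @[r --> \oo] --> (0 : R) &
       forall r : nat, (2 <= r)%N ->
         turan_density R r (Hgraph (k r) r)
           = (1 + eps r) * (((k r)%:R - 2) / r%:R))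
  /\
  (* (iii) *)
  (forall alpha beta : R, 0 < alpha < 1 ->
     beta = Num.min alpha (1 - alpha) ->
     (k r)%:R / r%:R @[r --> \oo] --> alpha ->
     exists2 eps : nat -> R, eps r @[r --> \oo] --> (0 : R) &
       forall r : nat, (2 <= r)%N ->
         0 <= ((k r)%:R - 2) / r%:R - turan_density R r (Hgraph (k r) r)
           <= (128 * Num.sqrt (beta * ln (expR 1 / beta)) + eps r)
                / Num.sqrt r%:R).
Proof.
split; first by move=> c c0; exact (density_log hk c0).
split; first exact (density_equiv hk).
by move=> alpha beta ab bE; exact (density_linear hk ab bE).
Qed.
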